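(* For each $1\le p<\infty$, the set $S_p([0,1])$ is $\ell_2$-spaceable in $L^p[0,1]$; that is, $S_p([0,1])\cup\{0\}$ contains a closed linear subspace of $L^p[0,1]$ isomorphic to $\ell_2$.
   Context: $[0,1]$ carries Lebesgue measure; functions are real-valued. For $0<q\le\infty$, a function $f$ on $[0,1]$ is nowhere $L^q$ if for each nonvoid open $U\subset[0,1]$ the restriction $f|_U$ is not in $L^q(U)$, and $$S_p([0,1])=\{f\in L^p[0,1]: f\text{ is nowhere }L^q\text{ for each }p<q\le\infty\}.$$ Isomorphic means linearly homeomorphic. A subset $S$ of a topological vector space $V$ is $W$-spaceable if $S\cup\{0\}$ contains a subspace of $V$ isomorphic to $W$. *)

(* Defs.v *)
From HB Require Import structures.
From mathcomp Require Import all_boot all_order all_algebra.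
From mathcomp Require Import all_classical all_reals all_analysis.
From mathcomp Require Import measurable_realfun ess_sup_inf.
Set Implicit Arguments.
Unset Strict Implicit.
Unset Printing Implicit Defensive.
Import Order.TTheory GRing.Theory Num.Theory.
Import numFieldNormedType.Exports.
Local Open Scope classical_set_scope.
Local Open Scope ring_scope.

(* The library's [LspaceType mu p1] (a.e.-equality classes of measurable
   functions with finite [L^p] norm) carries no algebraic structure; here it is
   made a normed module by computing on representatives in [LfunType mu p1]. *)
Section Lspace_normedModType.
Context d (T : measurableType d) (R : realType).
Variables (mu : {measure set T -> \bar R}) (p : \bar R) (p1 : (1 <= p)%E).

Local Notation Lp := (LspaceType mu p1).
Local Notation Lf := (LfunType mu p1).
Local Notation Lq := (@aeEqMfun _ _ R T (measurableTypeR R) mu).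

Lemma Lrepr_Lfun (x : Lp) : (x : T -> R) \in Lfun mu p.
Proof.
rewrite inE; apply/andP; split; rewrite inE/=.
  exact: (@measurable_funPT _ _ _ _ (repr (x : Lq))).
exact: Lebesgue_finite.
Qed.

Definition Lrepr (x : Lp) : Lf := Lfun_Sub p1 (Lrepr_Lfun x).

Lemma measurable_funTypeR (f : {mfun T >-> R}) :
  measurable_fun [set: T] (f : T -> measurableTypeR R).
Proof. exact: (@measurable_funPT _ _ _ _ f). Qed.

(* [R] and [measurableTypeR R] have the same sigma-algebra but different
   displays. *)
Definition mfunTypeR (f : {mfun T >-> R}) : {mfun T >-> measurableTypeR R} :=
  HB.pack (f : T -> measurableTypeR R)
    (@isMeasurableFun.Build _ _ T (measurableTypeR R) f
      (measurable_funTypeR f)).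

Definition Lclass_mfun (f : Lf) : Lq := (\pi_Lq%qT (mfunTypeR f))%qT.

Lemma Lclass_mfun_ae (f : Lf) : (Lclass_mfun f : T -> R) = f %[ae mu].
Proof.
suff /asboolP : ae_eq_op mu (repr (Lclass_mfun f)) (mfunTypeR f) by [].
by apply/(eqquotP Lq); rewrite reprK.
Qed.

Lemma Lnorm_ae (f g : {mfun T >-> R}) : (f : T -> R) = g %[ae mu] ->
  ('N[mu]_p[EFin \o f] = 'N[mu]_p[EFin \o g])%E.
Proof.
move=> fg; rewrite unlock /Lnorm; case: p p1 => [r r1|_|//].
- have mh (h : {mfun T >-> R}) :
      measurable_fun [set: T] ((fun x => `|(h x)%:E| `^ r)%E : T -> \bar R).
    apply: (measurableT_comp (measurable_poweR r)).
    by apply: measurableT_comp => //; exact/measurable_EFinP.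
  congr (_ `^ _)%E; apply: ae_eq_integral => //; [exact: mh|exact: mh|].
  by apply: filterS fg => x /[apply] /= ->.
- case: ifPn => // mu0; apply: eq_ess_sup.
  by apply: filterS fg => x /(_ I) /= ->.
Qed.

Lemma Lclass_mfun_finite (f : Lf) : finite_norm mu p (Lclass_mfun f).
Proof.
have mf : measurable_fun [set: T] (Lclass_mfun f : T -> R).
  exact: (@measurable_funPT _ _ _ _ (repr (Lclass_mfun f))).
pose g : {mfun T >-> R} := HB.pack (Lclass_mfun f : T -> R)
  (@isMeasurableFun.Build _ _ T R (Lclass_mfun f) mf).
have := @Lnorm_ae g f (Lclass_mfun_ae f).
by rewrite /finite_norm => ->; exact: Lfunction_finite.
Qed.

Definition Lclass (f : Lf) : Lp := HB.pack (Lclass_mfun f)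
  (@isFinLebesgue.Build _ _ _ mu p p1 (Lclass_mfun f) (Lclass_mfun_finite f)).

Lemma LclassK (f : Lf) : (Lrepr (Lclass f) : T -> R) = f %[ae mu].
Proof. exact: Lclass_mfun_ae. Qed.

Lemma Lspace_eqP (x y : Lp) : (Lrepr x : T -> R) = Lrepr y %[ae mu] -> x = y.
Proof.
move=> xy; have : x = y :> Lq.
  by rewrite -[LHS]reprK -[RHS]reprK; apply/(eqquotP Lq)/asboolP.
case: x y {xy} => [x [[xf]]] [y [[yf]]] /= xy.
subst y; congr LebesgueSpace.Pack; do 2 congr LebesgueSpace.Class.
congr isFinLebesgue.Axioms_; exact: Prop_irrelevance.
Qed.


HB.instance Definition _ := gen_eqMixin Lp.
HB.instance Definition _ := gen_choiceMixin Lp.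

Definition Lspace_add (x y : Lp) : Lp := Lclass (Lrepr x + Lrepr y).
Definition Lspace_opp (x : Lp) : Lp := Lclass (- Lrepr x).
Definition Lspace_scale (a : R) (x : Lp) : Lp := Lclass (a *: Lrepr x).


Lemma Lrepr_add (x y : Lp) :
  \forall t \ae mu, Lrepr (Lspace_add x y) t = Lrepr x t + Lrepr y t.
Proof. by apply: filterS (LclassK (Lrepr x + Lrepr y)) => t /(_ I) ->. Qed.

Lemma Lrepr_opp (x : Lp) :
  \forall t \ae mu, Lrepr (Lspace_opp x) t = - Lrepr x t.
Proof. by apply: filterS (LclassK (- Lrepr x)) => t /(_ I) ->. Qed.

Lemma Lrepr_scale (a : R) (x : Lp) :
  \forall t \ae mu, Lrepr (Lspace_scale a x) t = a * Lrepr x t.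
Proof. by apply: filterS (LclassK (a *: Lrepr x)) => t /(_ I) ->. Qed.

Lemma Lrepr_class0 : \forall t \ae mu, Lrepr (Lclass 0) t = 0.
Proof. by apply: filterS (LclassK 0) => t /(_ I) ->. Qed.

Lemma Lspace_addA : associative Lspace_add.
Proof.
move=> x y z; apply: Lspace_eqP.
apply: filterS2
  (filterI (Lrepr_add x (Lspace_add y z)) (Lrepr_add y z))
  (filterI (Lrepr_add (Lspace_add x y) z) (Lrepr_add x y)).
move=> t [-> ->] [-> ->] _.
by rewrite addrA.
Qed.

Lemma Lspace_addC : commutative Lspace_add.
Proof. by move=> x y; rewrite /Lspace_add addrC. Qed.

Lemma Lspace_add0 : left_id (Lclass 0) Lspace_add.
Proof.
move=> x; apply: Lspace_eqP.
apply: filterS2 (Lrepr_add (Lclass 0) x) Lrepr_class0 => t -> -> _.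
by rewrite add0r.
Qed.

Lemma Lspace_addN : left_inverse (Lclass 0) Lspace_opp Lspace_add.
Proof.
move=> x; apply: Lspace_eqP.
apply: filterS3 (Lrepr_add (Lspace_opp x) x) (Lrepr_opp x) Lrepr_class0.
by move=> t -> -> -> _; rewrite addNr.
Qed.

HB.instance Definition _ := GRing.isZmodule.Build Lp
  Lspace_addA Lspace_addC Lspace_add0 Lspace_addN.

Lemma Lspace_scaleA (a b : R) (x : Lp) :
  Lspace_scale a (Lspace_scale b x) = Lspace_scale (a * b) x.
Proof.
apply: Lspace_eqP.
apply: filterS3 (Lrepr_scale a (Lspace_scale b x)) (Lrepr_scale b x)
  (Lrepr_scale (a * b) x) => t -> -> -> _.
by rewrite mulrA.
Qed.

Lemma Lspace_scale1 : left_id 1 Lspace_scale.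
Proof.
move=> x; apply: Lspace_eqP.
by apply: filterS (Lrepr_scale 1 x) => t -> _; rewrite mul1r.
Qed.

Lemma LreprD (x y : Lp) :
  \forall t \ae mu, Lrepr (x + y) t = Lrepr x t + Lrepr y t.
Proof. exact: Lrepr_add. Qed.

Lemma Lrepr0 : \forall t \ae mu, Lrepr 0 t = 0.
Proof. exact: Lrepr_class0. Qed.

Lemma Lspace_scaleDr : right_distributive Lspace_scale +%R.
Proof.
move=> a x y; apply: Lspace_eqP.
apply: filterS3
  (filterI (Lrepr_scale a (x + y)) (LreprD x y))
  (LreprD (Lspace_scale a x) (Lspace_scale a y))
  (filterI (Lrepr_scale a x) (Lrepr_scale a y)) => t [-> ->] -> [-> ->] _.
by rewrite mulrDr.
Qed.

Lemma Lspace_scaleDl (x : Lp) : {morph Lspace_scale^~ x : a b / a + b}.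
Proof.
move=> a b; apply: Lspace_eqP.
apply: filterS3 (Lrepr_scale (a + b) x)
  (LreprD (Lspace_scale a x) (Lspace_scale b x))
  (filterI (Lrepr_scale a x) (Lrepr_scale b x)) => t -> -> [-> ->] _.
by rewrite mulrDl.
Qed.

HB.instance Definition _ := GRing.Zmodule_isLmodule.Build R Lp
  Lspace_scaleA Lspace_scale1 Lspace_scaleDr Lspace_scaleDl.

Lemma LreprZ (a : R) (x : Lp) :
  \forall t \ae mu, Lrepr (a *: x) t = a * Lrepr x t.
Proof. exact: Lrepr_scale. Qed.

Definition Lspace_norm (x : Lp) : R := fine ('N[mu]_p[EFin \o x])%E.

Lemma Lspace_normE (x : Lp) :
  Lspace_norm x = fine ('N[mu]_p[EFin \o Lrepr x])%E.
Proof. by []. Qed.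

Lemma Lspace_normD (x y : Lp) :
  Lspace_norm (x + y) <= Lspace_norm x + Lspace_norm y.
Proof.
rewrite !Lspace_normE (@Lnorm_ae _ (Lrepr x + Lrepr y)); last first.
  by apply: filterS (LreprD x y) => t + _.
exact: ler_LnormD.
Qed.

Lemma Lspace_normZ (a : R) (x : Lp) :
  Lspace_norm (a *: x) = `|a| * Lspace_norm x.
Proof.
rewrite !Lspace_normE (@Lnorm_ae _ (a *: Lrepr x)); last first.
  by apply: filterS (LreprZ a x) => t + _.
by rewrite [in LHS]LnormZ -finite_norm_fine -EFinM.
Qed.

Lemma Lspace_norm_eq0 (x : Lp) : Lspace_norm x = 0 -> x = 0.
Proof.
rewrite Lspace_normE => /fine_Lnormr_eq0 x0; apply: Lspace_eqP.
by apply: filterS2 x0 Lrepr0 => t /(_ I) + + _ => -> ->.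
Qed.

HB.instance Definition _ := Lmodule_isNormed.Build R Lp
  Lspace_normD Lspace_normZ Lspace_norm_eq0.

End Lspace_normedModType.

Section spaceability.
Context (R : realType).

(* [M] is the range of a linear map from [W] that is a homeomorphism onto [M];
   the inverse [g] is automatically linear on [M]. *)
Definition isomorphic_to (V W : topologicalLmodType R) (M : set V) :=
  exists (f : {linear W -> V}) (g : V -> W),
    [/\ continuous f, range f = M, cancel f g & {within M, continuous g}].

Definition spaceable (V W : topologicalLmodType R) (S : set V) :=
  exists M : set V,
    [/\ submod_closed [in M], M `<=` S `|` [set 0] & isomorphic_to W M].

End spaceability.

Section L01.
Context (R : realType).

Definition lebesgue_on (D : set (measurableTypeR R)) (mD : measurable D) :
  {measure set (measurableTypeR R) -> \bar R} := mrestr lebesgue_measure mD.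

(* Lebesgue measure on [0, 1], seen as a measure on the Borel sets of [R] that
   vanishes outside [0, 1]; its a.e. classes of functions on [R] are those of
   functions on [0, 1]. *)
Definition lebesgue01 := lebesgue_on (measurable_itv `[(0 : R), 1]).

(* [U] ranges over the relatively open subsets of [0, 1]. For [q < 1], [Lfun]
   still makes sense (finiteness of the integral of [`|f| `^ q]), although it
   is not a normed space. *)
Definition nowhere_L (q : \bar R) (f : measurableTypeR R -> R) :=
  forall (U : set R) (mU : measurable (U : set (measurableTypeR R))),
    (exists2 W : set R, open W & U = W `&` `[0, 1]) -> U !=set0 ->
    f \notin Lfun (lebesgue_on mU) q.

Lemma nowhere_L_ae (q : \bar R) (f g : {mfun measurableTypeR R >-> R}) :
  (1 <= q)%E -> (f : measurableTypeR R -> R) = g %[ae lebesgue01] ->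
  nowhere_L q f -> nowhere_L q g.
Proof.
move=> q1 [N [mN N0 fgN]] nf U mU [W oW UW] U0.
apply: contra (nf U mU (ex_intro2 _ _ W oW UW) U0) => /andP[_].
rewrite !inE /= /finite_norm => g_fin.
apply/andP; split; rewrite inE/=; first exact: (@measurable_funPT _ _ _ _ f).
rewrite /finite_norm (@Lnorm_ae _ _ _ _ _ q1 f g)//.
exists N; split => //.
apply: (@subset_measure0 _ _ _ lebesgue_measure _ _ _ _ _ N0).
- exact: measurableI.
- by apply: measurableI => //; exact: measurable_itv.
- by rewrite UW => x [Nx [_ ?]].
Qed.

(* [Lrepr f] is a representative of the class [f]; by [nowhere_L_ae] the
   condition does not depend on its choice. *)
Definition S01 (p : R) (p1 : (1 <= p%:E)%E) : set (LspaceType lebesgue01 p1) :=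
  [set f | forall q : \bar R, (p%:E < q)%E -> nowhere_L q (Lrepr f)].

End L01.
Arguments S01 {R p} p1.

Notation ell2 R := (LspaceType (@counting nat R) (lee1n 2)).

(* Main.v *)
(* Let r_n be the Rademacher functions on [0,1]. By Khinchin's inequality the
   sums g = \sum_n b_n r_{2n} over the even digits satisfy |g|_p ~ |b|_2. They are
   multiplied by h = W^{1/p}, where W = \sum_m 2^{-m} 2^{m^2} 1_{E_m} and E_m
   prescribes m^2 odd digits, starting at digit 2m+1. As W has integral 2 and is
   independent of g, |h g|_p ~ |b|_2 still holds. Every interval contains, for
   all large m, a cylinder of measure 2^{-2k-m^2} inside E_m on which h >= 2^{(m^2-m)/p};
   if b_n <> 0 for some n >= k, flipping the digit 2n shows that the integral of
   |h g| over this cylinder is at least |b_n| 2^{(m^2-m)/p} times its measure, which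
   is incompatible with h g being locally in L^q for some q > p. Finally, a in
   ell^2 is encoded by a sequence b with b_{2j} = a_j and b_{2j+1} = b_j / 2, so
   that |b|_2 ~ |a|_2 and b has infinitely many nonzero terms unless a = 0. *)
From HB Require Import structures.
Require Import Defs.
From mathcomp Require Import all_boot all_order all_algebra.
From mathcomp Require Import all_classical all_reals all_analysis.
From mathcomp Require Import measurable_realfun ess_sup_inf.
From mathcomp Require Import ring lra zify.
Import Order.TTheory GRing.Theory Num.Theory.
Import numFieldNormedType.Exports.
Local Open Scope classical_set_scope.
Local Open Scope ring_scope.

(** * The space L^p *)

Section Lclass_theory.
Context {d} {T : measurableType d} {R : realType} {mu : {measure set T -> \bar R}}
  {p : \bar R} {p1 : (1 <= p)%E}.
Local Notation Lp := (LspaceType mu p1).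

(** Infinitely many nonzero b_n are needed because a finite sum can vanish on an interval, as r_0 +
    r_2 does, and h g vanishes with it; if nonzero b_n occur arbitrarily far out, some digit 2n is
    left free by any prescription of the first 2k digits. The exponent m^2 serves two ends: E_m has
    measure 2^{-m^2}, so the factor 2^{-m} makes W integrable, while for s > p the integral of h^s
    over E_m is at least 2^{m^2 (s/p - 1) - m s/p}, where m^2 beats m however close s is to p.
    Starting E_m at 2m+1 keeps it away from the first 2k digits once m >= k, and using odd digits
    keeps h invariant under flips of the even ones. This invariance, with the fact that flips
    preserve the measure, replaces independence throughout. The estimate on a cylinder is an L^1
    bound through the single coefficient b_n, so it holds with one constant for all partial sums
    beyond n and passes to their limit in L^p. *)

Lemma Lrepr_ae_inj (x y : Lp) :
  (\forall t \ae mu, Lrepr x t = Lrepr y t) -> x = y.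
Proof. by move=> xy; apply: Lspace_eqP; apply: filterS xy => t + _. Qed.

Lemma Lclass_ae (f : LfunType mu p1) : \forall t \ae mu, Lrepr (Lclass f) t = f t.
Proof. by apply: filterS (LclassK f) => t /(_ I). Qed.

Lemma LclassD (f g : LfunType mu p1) : Lclass (f + g) = Lclass f + Lclass g.
Proof.
apply: Lrepr_ae_inj.
apply: filterS2 (filterI (Lclass_ae f) (Lclass_ae g))
  (filterI (Lclass_ae (f + g)) (LreprD (Lclass f) (Lclass g))).
by move=> t [e1 e2] [e3 e4]; rewrite e3 e4 e1 e2.
Qed.

Lemma LclassZ (a : R) (f : LfunType mu p1) : Lclass (a *: f) = a *: Lclass f.
Proof.
apply: Lrepr_ae_inj.
apply: filterS3 (Lclass_ae f) (Lclass_ae (a *: f)) (LreprZ a (Lclass f)).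
by move=> t e1 e2 e3; rewrite e2 e3 e1.
Qed.

Lemma LreprK (x : Lp) : Lclass (Lrepr x) = x.
Proof. exact: Lrepr_ae_inj (Lclass_ae _). Qed.

Lemma LclassB (f g : LfunType mu p1) : Lclass (f - g) = Lclass f - Lclass g.
Proof. by rewrite LclassD -scaleN1r LclassZ scaleN1r. Qed.

Lemma norm_Lclass (f : LfunType mu p1) :
  `|Lclass f|%:E = 'N[mu]_p[EFin \o f]%E.
Proof.
rewrite -finite_norm_fine; congr (_%:E).
rewrite [LHS]Lspace_normE; congr fine; apply: Lnorm_ae => //.
exact: LclassK.
Qed.

Lemma norm_Lrepr (x : Lp) : `|x|%:E = 'N[mu]_p[EFin \o Lrepr x]%E.
Proof. by rewrite -[in LHS](LreprK x) norm_Lclass. Qed.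

Lemma Lrepr_measurable (x : Lp) : measurable_fun [set: T] (Lrepr x).
Proof. exact: (@measurable_funPT _ _ _ _ (Lrepr x)). Qed.

End Lclass_theory.

Section Lnorm_real.
Context {d} {T : measurableType d} {R : realType} {mu : {measure set T -> \bar
  R}} {p : R}.
Local Open Scope ereal_scope.

Lemma measurable_abs_powR (f : T -> R) : measurable_fun [set: T] f ->
  measurable_fun [set: T] (fun x => (`|f x| `^ p)%:E).
Proof.
move=> mf; apply/measurable_EFinP; apply: (measurableT_comp (measurable_powR p)).
exact: measurableT_comp mf.
Qed.

Lemma Lnorm_powR (f : T -> R) : p != 0%R ->
  'N[mu]_p%:E[EFin \o f] `^ p = \int[mu]_x (`|f x| `^ p)%:E.
Proof. by move=> p0; rewrite powR_Lnorm//; apply: eq_integral => x _. Qed.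

Lemma Lfun_real (f : T -> R) : (0 < p)%R -> measurable_fun [set: T] f ->
  (f \in Lfun mu p%:E) = (\int[mu]_x (`|f x| `^ p)%:E < +oo).
Proof.
move=> p0 mf; rewrite -Lnorm_powR ?gt_eqF//; apply/idP/idP.
  by move=> /andP[_]; rewrite inE /= /finite_norm => /poweR_lty; exact.
move=> /lty_poweRy fp; apply/andP; split; rewrite inE//=.
by apply: fp; rewrite gt_eqF.
Qed.

End Lnorm_real.

Section Lspace_real.
Context {d} {T : measurableType d} {R : realType} {mu : {measure set T -> \bar R}}
  {p : R} {p1 : (1 <= p%:E)%E}.
Local Notation Lp := (LspaceType mu p1).

Lemma norm_LreprX (x : Lp) :
  ((`|x| `^ p)%:E = \int[mu]_t (`|Lrepr x t| `^ p)%:E)%E.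
Proof.
have p0 : p != 0 by rewrite gt_eqF// (lt_le_trans ltr01).
by rewrite -Lnorm_powR// -norm_Lrepr poweR_EFin.
Qed.

Lemma norm_LclassX (f : LfunType mu p1) :
  ((`|Lclass f| `^ p)%:E = \int[mu]_t (`|f t| `^ p)%:E)%E.
Proof.
have p0 : p != 0 by rewrite gt_eqF// (lt_le_trans ltr01).
by rewrite -Lnorm_powR// -norm_Lclass poweR_EFin.
Qed.

Lemma norm_LclassX_le (f : LfunType mu p1) (c : R) : 0 <= c ->
  (\int[mu]_t (`|f t| `^ p)%:E <= (c `^ p)%:E)%E -> `|Lclass f| <= c.
Proof.
have p0 : 0 < p by rewrite (lt_le_trans ltr01).
move=> c0; rewrite -norm_LclassX lee_fin => /(@ge0_ler_powR _ p^-1).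
rewrite !nnegrE !powR_ge0 invr_ge0 ltW// => /(_ isT isT isT).
by rewrite -!powRrM mulfV ?gt_eqF// !powRr1.
Qed.

End Lspace_real.

(** * Completeness of L^p (Riesz-Fischer) *)

Lemma sum_half (R : realType) (m n : nat) :
  \sum_(k < n) (2^-1 : R) ^+ (m + k) = 2 * (2^-1 ^+ m - 2^-1 ^+ (m + n)).
Proof.
elim: n => [|n IH]; first by rewrite big_ord0 addn0 subrr mulr0.
by rewrite big_ord_recr /= IH addnS exprS; field.
Qed.

Lemma limn_einf_le_near (R : realType) (u : (\bar R)^nat) (B : \bar R) (N : nat) :
  (forall j, (N <= j)%N -> (u j <= B)%E) -> (limn_einf u <= B)%E.
Proof.
move=> uB; rewrite limn_einf_lim; apply: lime_le; first exact: is_cvg_einfs.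
near=> k; apply: le_trans (uB k _); last by near: k; exact: nbhs_infty_ge.
by apply: ereal_inf_lbound; exists k => /=.
Unshelve. all: by end_near. Qed.

(** Differentiability of the power gives continuity at positive points only, so the limit 0 is
    treated by hand. *)
Lemma cvg_powR (R : realType) (p : R) (v : nat -> R) (l : R) : 0 < p ->
  (forall n, 0 <= v n) -> v n @[n --> \oo] --> l ->
  v n `^ p @[n --> \oo] --> l `^ p.
Proof.
move=> p0 v0 vl; have l0 : 0 <= l.
  by rewrite -(cvg_lim _ vl)//; apply: limr_ge; [exact: cvgP vl|exact: nearW].
move: l0 vl; rewrite le_eqVlt => /predU1P[<-|l0] vl; last first.
  have cp : {for l, continuous (fun x : R => x `^ p)}; last first.
    exact: (continuous_cvg _ cp vl).
  apply: differentiable_continuous; apply/derivable1_diffP.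
  by apply: derivable_powR; rewrite in_itv/= l0.
rewrite powR0 ?gt_eqF//; apply/cvgrPdist_le => e e0.
have /cvgrPdist_le /(_ (e `^ p^-1)) := vl; rewrite powR_gt0// => /(_ isT).
apply: filterS => n; rewrite !sub0r !normrN !ger0_norm ?powR_ge0// => ve.
rewrite -[leRHS]powRr1 ?(ltW e0)// -(mulVf (lt0r_neq0 p0)) powRrM.
by rewrite ge0_ler_powR ?nnegrE ?powR_ge0 ?(ltW p0).
Qed.

Section Lspace_complete.
Context {d} {T : measurableType d} {R : realType} {mu : {measure set T -> \bar R}}
  {p : R} {p1 : (1 <= p%:E)%E}.
Local Notation Lp := (LspaceType mu p1).
Let p0 : 0 < p. Proof. by rewrite (lt_le_trans ltr01). Qed.

Section fast.
Variable x : nat -> Lp.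
Hypothesis xfast : forall k, `|x k.+1 - x k| <= 2^-1 ^+ k.
Let u k : T -> R := Lrepr (x k).
(** By Minkowski these sums have norm at most 2, so by monotone convergence the limit [H] of their
    p-th powers is integrable, hence finite almost everywhere. Where it is finite, the telescoping
    series of the [u k] converges absolutely. *)
Let G n t := \sum_(k < n) `|u k.+1 t - u k t|.

Let mu_ k : measurable_fun [set: T] (u k).
Proof. exact: Lrepr_measurable. Qed.

Let mG n : measurable_fun [set: T] (G n).
Proof.
apply: measurable_sum => k; apply: measurableT_comp => //.
exact: measurable_funB.
Qed.

Let normG n : ('N[mu]_p%:E[EFin \o G n] <= (2 * (1 - 2^-1 ^+ n))%:E)%E.
Proof.
elim: n => [|n IH].
  rewrite subrr mulr0 (_ : EFin \o G 0 = cst 0%E) ?Lnorm0//.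
    by rewrite eqe gt_eqF.
  by apply/funext => t /=; rewrite /G big_ord0.
have -> : EFin \o G n.+1 = EFin \o (G n \+ (fun t => `|u n.+1 t - u n t|)).
  by apply/funext => t /=; rewrite /G big_ord_recr.
apply: (le_trans (minkowski_EFin _ _ _ _)) => //.
  by apply: measurableT_comp => //; exact: measurable_funB.
have -> : 2 * (1 - 2^-1 ^+ n.+1) = 2 * (1 - 2^-1 ^+ n) + 2^-1 ^+ n :> R.
  by rewrite exprS; field.
rewrite EFinD; apply: leeD => //.
rewrite -[leLHS]Lnorm_abse.
have -> : abse \o (EFin \o (fun t => `|u n.+1 t - u n t|)) =
    abse \o (EFin \o (fun t => u n.+1 t - u n t)).
  by apply/funext => t /=; rewrite normr_id.
rewrite Lnorm_abse; apply: le_trans (_ : (`|x n.+1 - x n|%:E <= _)%E); last first.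
  by rewrite lee_fin.
rewrite -[x n.+1]LreprK -[x n]LreprK -LclassB norm_Lclass.
by [].
Qed.

Let intG n : (\int[mu]_t (G n t `^ p)%:E <= (2 `^ p)%:E)%E.
Proof.
have G0 t : 0 <= G n t by apply: sumr_ge0.
under eq_integral do rewrite -[G n _]ger0_norm ?G0//.
rewrite -Lnorm_powR ?gt_eqF// -poweR_EFin gt0_ler_poweR//; first exact: ltW.
- by rewrite in_itv/= Lnorm_ge0 leey.
- by rewrite in_itv/= lee_fin leey ler0n.
apply: le_trans (normG n) _; rewrite lee_fin ler_piMr//.
Qed.

Let H t : \bar R := limn (fun n => (G n t `^ p)%:E).

Let ndG t : {homo G^~ t : m n / (m <= n)%N >-> m <= n}.
Proof.
apply/nondecreasing_seqP => n; rewrite /G big_ord_recr/= lerDl.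
exact: normr_ge0.
Qed.

Let G0 n t : 0 <= G n t. Proof. exact: sumr_ge0. Qed.

Let ndGp t : {homo (fun n => (G n t `^ p)%:E) : m n / (m <= n)%N >-> (m <= n)%E}.
Proof.
move=> m n mn; rewrite lee_fin ge0_ler_powR ?(ltW p0) ?nnegrE ?G0//.
exact: ndG.
Qed.

Let mGp n : measurable_fun [set: T] (fun t => (G n t `^ p)%:E).
Proof.
apply/measurable_EFinP; exact: (measurableT_comp (measurable_powR p)).
Qed.

Let mH : measurable_fun [set: T] H.
Proof.
apply: (emeasurable_fun_cvg (fun n t => (G n t `^ p)%:E)) => // t _.
apply: ereal_nondecreasing_is_cvgn; exact: ndGp.
Qed.

Let H0 t : (0 <= H t)%E.
Proof.
apply: lime_ge; first by apply: ereal_nondecreasing_is_cvgn; exact: ndGp.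
by apply: nearW => n; rewrite lee_fin powR_ge0.
Qed.

Let Hfin : \forall t \ae mu, H t \is a fin_num.
Proof.
suff : mu.-integrable [set: T] H.
  by move/(integrable_ae measurableT); apply: filterS => t /(_ I).
apply/integrableP; split => //.
under eq_integral do rewrite gee0_abs//.
rewrite /H monotone_convergence//.
- apply: (@le_lt_trans _ _ (2 `^ p)%:E); last exact: ltry.
  apply: lime_le; last exact: nearW.
  apply: ereal_nondecreasing_is_cvgn => m n mn.
  apply: ge0_le_integral => //.
  - by move=> t _; rewrite lee_fin powR_ge0.
  - by move=> t _; exact: ndGp.
- by move=> n t _; rewrite lee_fin powR_ge0.
Qed.

Let u_cvg t : H t \is a fin_num -> cvgn (u^~ t).
Proof.
move=> Ht.
have Gb : exists M, forall n, G n t <= M.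
  exists (fine (H t) `^ p^-1) => n.
  rewrite -[leLHS]powRr1// -(mulfV (lt0r_neq0 p0)) powRrM.
  rewrite ge0_ler_powR ?invr_ge0 ?nnegrE ?powR_ge0 ?(ltW p0) ?fine_ge0//.
  rewrite -lee_fin fineK//.
  rewrite /H (cvg_lim _ (ereal_nondecreasing_cvgn (ndGp t)))//.
  by apply: ereal_sup_ubound; exists n.
have [M GM] := Gb.
have : cvgn [normed series (fun k => u k.+1 t - u k t)].
  rewrite (_ : [normed series _] = G^~ t); last first.
    by apply/funext => n; rewrite /normed_series_of seriesEord.
  apply: nondecreasing_is_cvgn; first exact: ndG.
  by exists M => _ [n _ <-].
move=> /normed_cvg.
rewrite (_ : series _ = fun n => u n t - u 0 t); last first.
  by apply/funext => n; rewrite /series/= telescope_sumr.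
move=> c; have := is_cvgD c (is_cvg_cst (u 0 t)).
move=> /(_ _ _); rewrite (_ : _ + _ = u^~ t); first exact.
by apply/funext => n; rewrite /GRing.add/= subrK.
Qed.

Let mN : measurable [set t | H t \is a fin_num].
Proof. by have := emeasurable_fin_num measurableT mH; rewrite setTI. Qed.

(** The indicator makes the sequence converge at every point, so that its limit is measurable; it
    changes each [u n] on a null set only. *)
Let f t := limn (fun n => u n t * \1_[set t | H t \is a fin_num] t).

Let f_cvg t : u n t * \1_[set t | H t \is a fin_num] t @[n --> \oo] --> f t.
Proof.
rewrite /f indicE; have [tN|tN] := boolP (t \in _).
  by apply: is_cvgMl; apply: u_cvg; rewrite inE in tN.
by under eq_fun do rewrite mulr0; exact: is_cvg_cst.
Qed.

Let mf : measurable_fun [set: T] f.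
Proof.
apply: (measurable_fun_cvg (h := fun n t => u n t * \1_[set t | H t \is a
  fin_num] t)) => //.
by move=> n; apply: measurable_funM => //; exact: measurable_indic.
Qed.

Let dist_fast n j : (n <= j)%N -> `|x j - x n| <= 2 * 2^-1 ^+ n.
Proof.
move=> nj; rewrite -(subnKC nj); move: (j - n)%N => k.
apply: (@le_trans _ _ (\sum_(i < k) 2^-1 ^+ (n + i))); last first.
  by rewrite sum_half ler_pM2l// gerBl exprn_ge0// invr_ge0.
elim: k => [|k IH]; first by rewrite addn0 subrr normr0 big_ord0.
rewrite big_ord_recr/= addnS -(subrKA (x (n + k))) (le_trans (ler_normD _ _))//.
by rewrite addrC lerD.
Qed.

(** Fatou's lemma for [j] tending to infinity in the distance from [u j] to [u n], which [dist_fast]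
    bounds uniformly in [j >= n]. *)
Let int_dist n : (\int[mu]_t (`|f t - u n t| `^ p)%:E <= ((2 * 2^-1 ^+ n) `^
  p)%:E)%E.
Proof.
pose v j t := u j t * \1_[set t | H t \is a fin_num] t.
have mv j : measurable_fun [set: T] (v j).
  by apply: measurable_funM => //; exact: measurable_indic.
have vu j : \forall t \ae mu, v j t = u j t.
  by apply: filterS Hfin => t Ht; rewrite /v indicE mem_set// mulr1.
have mfu j : measurable_fun [set: T] (fun t => (`|v j t - v n t| `^ p)%:E).
  by apply: measurable_abs_powR; exact: measurable_funB.
rewrite (ae_eq_integral (fun t => (`|f t - v n t| `^ p)%:E))//.
- rewrite (eq_integral (fun t => limn_einf (fun j => (`|v j t - v n t| `^ p)%:E))).
    apply: le_trans (fatou _ _ _ _) _ => //.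
    apply: (limn_einf_le_near _ _ _ n) => j nj.
    rewrite (ae_eq_integral (fun t => (`|(Lrepr (x j) - Lrepr (x n)) t| `^
      p)%:E))//.
    + rewrite -norm_LclassX LclassB !LreprK lee_fin ge0_ler_powR ?nnegrE ?(ltW
        p0)//.
      exact: dist_fast.
    + by apply: measurable_abs_powR; exact: measurable_funB.
    + by apply: filterS2 (vu j) (vu n) => t -> -> _.
  move=> t _; apply/esym; apply: (cvg_limn_einf_sup _).1.
  apply: cvg_EFin; first exact: nearW.
  apply: cvg_powR => //; apply: cvg_norm; apply: cvgB; first exact: f_cvg.
  exact: cvg_cst.
- by apply: measurable_abs_powR; exact: measurable_funB.
- by apply: measurable_abs_powR; exact: measurable_funB.
- by apply: filterS (vu n) => t ->.
Qed.

Lemma Lspace_cvg_fast : exists l : Lp, forall n, `|l - x n| <= 2 * 2^-1 ^+ n.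
Proof.
have fB n : (fun t => f t - u n t) \in Lfun mu p%:E.
  rewrite Lfun_real//; last exact: measurable_funB.
  by rewrite (le_lt_trans (int_dist n))// ltry.
have fL : f \in Lfun mu p%:E.
  have := rpredD (fB 0) (LfunP (Lrepr (x 0))).
  rewrite (_ : _ + _ = f); first exact.
  by apply/funext => t; rewrite /GRing.add/= subrK.
exists (Lclass (Lfun_Sub p1 fL)) => n.
rewrite -[x n]LreprK -LclassB; apply: norm_LclassX_le.
  by rewrite mulr_ge0// exprn_ge0// invr_ge0.
exact: int_dist.
Qed.

End fast.

Lemma Lspace_complete (x : nat -> Lp) :
  (forall e, 0 < e -> exists N, forall m n, (N <= m)%N -> (N <= n)%N ->
     `|x m - x n| <= e) ->
  exists l : Lp, x n @[n --> \oo] --> l.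
Proof.
move=> xC.
have [N N_] : {N : nat -> nat & forall k m n, (N k <= m)%N -> (N k <= n)%N ->
     `|x m - x n| <= 2^-1 ^+ k}.
  apply: (@choice _ _ (fun k N => forall m n, (N <= m)%N -> (N <= n)%N ->
     `|x m - x n| <= 2^-1 ^+ k)) => k.
  by apply: xC; rewrite exprn_gt0// invr_gt0.
(* [N] need not be monotone; with its running maximum, both [M k] and [M k.+1] are at least
   [N k]. *)
pose M k := \max_(i < k.+1) N i.
have NM k : (N k <= M k)%N by rewrite /M (leq_bigmax (ord_max : 'I_k.+1)).
have MM k : (M k <= M k.+1)%N by rewrite /M [leqRHS]big_ord_recr/= leq_maxl.
have [l lx] := @Lspace_cvg_fast (x \o M)
  (fun k => N_ k _ _ (leq_trans (NM k) (MM k)) (NM k)).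
exists l; apply/cvgrPdist_le => e e0.
near \oo => k.
near=> n.
rewrite -(subrKA (x (M k))) (le_trans (ler_normD _ _))//.
apply: (@le_trans _ _ (2 * 2^-1 ^+ k + 2^-1 ^+ k)).
  apply: lerD; first exact: lx.
  by apply: N_ => //; near: n; exact: nbhs_infty_ge.
have -> : 2 * 2^-1 ^+ k + 2^-1 ^+ k = geometric 3 2^-1 k :> R by rewrite /=; ring.
near: k.
have := @cvg_geometric R 3 2^-1.
rewrite ger0_norm// invf_lt1// ltr1n => /(_ isT) /cvgrPdist_le /(_ e e0).
by apply: filterS => k /=; rewrite sub0r normrN => /(le_trans (ler_norm _)).
Unshelve. all: by end_near. Qed.

End Lspace_complete.

(** * Binary digits and their flips *)

Section digits.
Context {R : realType}.
Implicit Types (x y : R) (n j : nat).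
Local Notation mu := (@lebesgue_measure R).

Definition dyfloor n x : int := Num.floor (2 ^+ n * x).

Definition digit n x : int := dyfloor n.+1 x - 2 * dyfloor n x.

Definition rad n x : R := 1 - 2 * (digit n x)%:~R.

(** The term added is plus or minus the place value of digit [n], according as that digit is 0 or 1.
    Working on the whole line keeps the digit identities free of side conditions. *)
Definition flip n x : R := x + rad n x / 2 ^+ n.+1.

Lemma digit01 n x : digit n x = 0 \/ digit n x = 1.
Proof.
have /andP[l1 u1] := floor_itv (2 ^+ n * x).
have /andP[l2 u2] := floor_itv (2 ^+ n.+1 * x).
rewrite -/(dyfloor n x) in l1 u1; rewrite -/(dyfloor n.+1 x) in l2 u2.
rewrite exprS -mulrA in l2 u2; rewrite /digit.
move: (dyfloor n x) (dyfloor n.+1 x) l1 u1 l2 u2 => a b l1 u1 l2 u2.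
have : 2 * a < b + 1.
  rewrite -(ltr_int R); apply: le_lt_trans u2.
  by rewrite rmorphM/= ler_pM2l.
have : b < 2 * (a + 1).
  rewrite -(ltr_int R); apply: le_lt_trans l2 _.
  by rewrite rmorphM/= ltr_pM2l.
lia.
Qed.

Lemma rad1 n x : rad n x = 1 \/ rad n x = -1.
Proof. by rewrite /rad; case: (digit01 n x) => ->; [left|right]; ring. Qed.

Lemma dyfloor_flip_gt n j x : (n < j)%N ->
  dyfloor j (flip n x) = dyfloor j x + 2 ^+ (j - n.+1) * (1 - 2 * digit n x).
Proof.
move=> nj; rewrite /dyfloor /flip mulrDr.
have -> : 2 ^+ j * (rad n x / 2 ^+ n.+1) =
    (2 ^+ (j - n.+1) * (1 - 2 * digit n x))%:~R.
  rewrite -{1}(subnK nj) exprD rmorphM rmorphXn /= rmorphB rmorphM/= /rad.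
  by field; rewrite expf_neq0.
by rewrite floorDrz ?intr_int// intrKfloor.
Qed.

(** Downward induction from [j = n]: since digits are 0 or 1, [dyfloor j] is half of [dyfloor j.+1]
    rounded down, and at level [n.+1] the flip changes only the last bit. *)
Lemma dyfloor_flip_le n j x : (j <= n)%N -> dyfloor j (flip n x) = dyfloor j x.
Proof.
move=> /subnK <-; move: (n - j)%N => k.
elim: k j => [|k IH] j.
  have := dyfloor_flip_gt (0 + j) j.+1 x (ltnSn _).
  rewrite add0n subnn expr0 mul1r.
  have := digit01 j x; have := digit01 j (flip j x); rewrite /digit; lia.
have := IH j.+1; rewrite addnS -addSn.
have := digit01 j x; have := digit01 j (flip (k.+1 + j) x); rewrite /digit; lia.
Qed.

Lemma digit_flip n j x :
  digit j (flip n x) = if j == n then 1 - digit n x else digit j x.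
Proof.
rewrite /digit; case: ltngtP => [jn|nj|->].
- by rewrite !dyfloor_flip_le// ltnW.
- rewrite (dyfloor_flip_gt _ _ x (leqW nj)) (dyfloor_flip_gt _ _ x nj) subSn//
    exprS; ring.
- rewrite dyfloor_flip_gt// dyfloor_flip_le// subnn expr0 /digit; ring.
Qed.

Lemma rad_flip n j x : rad j (flip n x) = if j == n then - rad j x else rad j x.
Proof.
by rewrite /rad digit_flip; case: eqP => [->|//]; rewrite rmorphB/=; ring.
Qed.

Lemma flip_unit n x : (0 <= flip n x < 1) = (0 <= x < 1).
Proof.
have E y : (0 <= y < 1) = (dyfloor 0 y == 0).
  by rewrite /dyfloor expr0 mul1r floor_eq.
by rewrite !E dyfloor_flip_le.
Qed.

Lemma dyadic_close n x y : 0 <= x < 1 -> 0 <= y < 1 ->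
  (forall j, (j < n)%N -> rad j x = rad j y) -> `|x - y| < 2 ^- n.
Proof.
move=> x01 y01 xy.
have F0 z : 0 <= z < 1 -> dyfloor 0 z = 0.
  by move=> z01; apply/eqP; rewrite /dyfloor expr0 mul1r floor_eq.
have F k : (k <= n)%N -> dyfloor k x = dyfloor k y.
  elim: k => [_|k IH kn]; first by rewrite !F0.
  have := IH (ltnW kn); have := xy k kn; rewrite /rad => e.
  have : (digit k x)%:~R = (digit k y)%:~R :> R by lra.
  by move/(@intr_inj R); rewrite /digit; lia.
have := F n (leqnn n); rewrite /dyfloor => e.
have := floor_itv (2 ^+ n * x); have := floor_itv (2 ^+ n * y).
rewrite e => /andP[l1 u1] /andP[l2 u2].
rewrite -[ltRHS]mul1r ltr_pdivlMr ?exprn_gt0// -[X in _ * X]ger0_norm ?exprn_ge0//.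
rewrite -normrM mulrBl ltr_norml !(mulrC _ (2 ^+ n)).
rewrite rmorphD/= in u1 u2.
by apply/andP; split; lra.
Qed.

Lemma measurable_dyfloor n :
  measurable_fun [set: R] (fun x => (dyfloor n x)%:~R : R).
Proof.
apply: nondecreasing_measurable => // x y xy.
by rewrite ler_int /dyfloor le_floor// ler_pM2l// exprn_gt0.
Qed.

Lemma measurable_rad n : measurable_fun [set: measurableTypeR R] (rad n).
Proof.
have -> : rad n = fun x =>
    1 - 2 * ((dyfloor n.+1 x)%:~R - 2 * (dyfloor n x)%:~R).
  by apply/funext => x; rewrite /rad /digit rmorphB rmorphM.
apply: measurable_funB => //; apply: measurable_funM => //.
apply: measurable_funB; first exact: measurable_dyfloor.
by apply: measurable_funM => //; exact: measurable_dyfloor.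
Qed.

Lemma measurable_flip n :
  measurable_fun [set: measurableTypeR R] (flip n : _ -> measurableTypeR R).
Proof.
apply: measurable_funD => //; apply: measurable_funM => //.
exact: measurable_rad.
Qed.

Lemma lebesgue_measure_shift (t : R) (A : set R) : measurable (A : set
  (measurableTypeR R)) ->
  mu ((fun x => x + t) @^-1` A) = mu A.
Proof.
have mt : measurable_fun [set: measurableTypeR R]
    ((fun x : R => x + t) : _ -> measurableTypeR R).
  exact: measurable_funD.
move=> mA; apply/esym.
rewrite (@lebesgue_measure_unique R (pushforward mu
  ((fun x : R => x + t) : measurableTypeR R -> measurableTypeR R)))//.
move=> _ [[a b]] _ <-; rewrite [RHS](_ : _ = mu `]a - t, b - t]%classic); last
  first.
  congr mu; by apply/seteqP; split => x /=; rewrite !in_itv/= ltrBlDr lerBrDr.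
rewrite !lebesgue_measure_itv/= !lte_fin ltrD2r; case: ifPn => // _.
by rewrite -!EFinB; congr EFin; ring.
Qed.

(** The flip translates [D] onto its complement and the complement back onto [D]. Splitting along
    [D] reduces the claim to translation invariance, with the two pieces exchanged. *)
Lemma lebesgue_measure_flip n (A : set R) :
  measurable (A : set (measurableTypeR R)) -> mu (flip n @^-1` A) = mu A.
Proof.
move=> mA.
pose D : set R := [set x | rad n x = 1].
have mD : measurable (D : set (measurableTypeR R)).
  have := measurable_rad n measurableT _ (@measurable_set1 R 1).
  by rewrite setTI.
have mDC : measurable (~` D : set (measurableTypeR R)) by exact: measurableC.
have flipK x : flip n (flip n x) = x.
  by rewrite {1}/flip rad_flip eqxx /flip; field; rewrite expf_neq0.
have radC x : rad n (flip n x) = - rad n x by rewrite rad_flip eqxx.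
have flipD x : D x -> flip n x = x + 2 ^- n.+1 by rewrite /D/= /flip => ->;
  rewrite mul1r.
have flipDC x : ~ D x -> flip n x = x - 2 ^- n.+1.
  by rewrite /D/= /flip; case: (rad1 n x) => -> // _; rewrite mulN1r.
have mpre : measurable (flip n @^-1` A : set (measurableTypeR R)).
  by rewrite -[X in measurable X]setTI; exact: measurable_flip.
have shiftD x : D x <-> ~ D (x + 2 ^- n.+1).
  split=> [Dx|Dx].
    by rewrite -flipD// /D/= radC Dx => /eqP; apply/negP/eqP; lra.
  rewrite /D/= -[x](addrK (2 ^- n.+1)) -flipDC// radC.
  by case: (rad1 n (x + 2 ^- n.+1)) Dx => [? []//|->]; rewrite opprK.
have E B : measurable (B : set (measurableTypeR R)) -> mu B = (mu (B `&` D) + mu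
  (B `&` ~` D))%E.
  move=> mB; rewrite -[in LHS](setIT B) -(setUv D) setIUr measureU//.
  - exact: measurableI.
  - exact: measurableI.
  - by rewrite setIACA setICr setI0.
rewrite (E _ mpre) (E _ mA) addeC; congr (_ + _)%E.
- rewrite -(lebesgue_measure_shift (- 2 ^- n.+1) (A `&` D)); last exact:
    measurableI.
  congr mu; apply/seteqP; split => x /=.
    move=> [Ax Dx]; rewrite -flipDC//; split => //.
    by rewrite flipDC// (shiftD _) subrK.
  move=> [Ax Dx]; have Dx' : ~ D x by move: Dx; rewrite (shiftD _) subrK.
  by rewrite flipDC.
- rewrite -(lebesgue_measure_shift (2 ^- n.+1) (A `&` ~` D)); last exact:
    measurableI.
  congr mu; apply/seteqP; split => x /=.
    by move=> [Ax Dx]; rewrite -(shiftD x); split => //; rewrite -flipD.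
  by move=> [Ax]; rewrite -(shiftD x) => Dx; rewrite flipD.
Qed.

(** Flips preserve [[0, 1[] but not [[0, 1]]: the point 1 is moved to the right. Hence the measure
    is first rewritten without this null point. *)
Lemma lebesgue01_flip n (A : set R) : measurable (A : set (measurableTypeR R)) ->
  lebesgue01 R (flip n @^-1` A) = lebesgue01 R A.
Proof.
move=> mA.
have mI : measurable (`[0, 1[ : set (measurableTypeR R)) by exact: measurable_itv.
have m1 : measurable ([set 1] : set (measurableTypeR R)) by exact: measurable_set1.
have E B : measurable (B : set (measurableTypeR R)) ->
    lebesgue01 R B = mu (B `&` `[0, 1[).
  move=> mB; rewrite /lebesgue01 /lebesgue_on/= /mrestr.
  have -> : `[(0 : R), 1]%classic = `[0, 1[ `|` [set 1].
    by rewrite setUitv1// bnd_simp.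
  rewrite setIUr measureU//.
  - rewrite [X in (_ + X)%E](_ : _ = 0%E) ?adde0//.
    apply: (@subset_measure0 _ _ _ mu _ [set 1]) => //.
    + exact: measurableI.
    + exact: lebesgue_measure_set1.
  - exact: measurableI.
  - exact: measurableI.
  - apply/seteqP; split => // x [[_ /= +] [_ /= x1]].
    by rewrite x1 in_itv/= ltxx andbF.
rewrite !E//; last by rewrite -[X in measurable X]setTI; exact: measurable_flip.
rewrite -[RHS](lebesgue_measure_flip n); last exact: measurableI.
congr mu; apply/seteqP; split => x /= [Ax];
  by rewrite /= !in_itv/= flip_unit.
Qed.

End digits.

(** * Khinchin's inequality *)

(* The involutions [tau n] are a substitute for independence: averaging over
   [tau n] integrates out the sign [r n]. *)
Record sign_flips {d} {T : measurableType d} {R : realType}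
    (P : {measure set T -> \bar R}) (r : nat -> T -> R) (tau : nat -> T -> T) :
      Prop := SignFlips {
  sign_flips1 : forall n x, r n x = 1 \/ r n x = -1 ;
  measurable_sign : forall n, measurable_fun [set: T] (r n) ;
  measurable_tau : forall n, measurable_fun [set: T] (tau n) ;
  sign_tau : forall n k x, r k (tau n x) = if k == n then - r k x else r k x ;
  measure_tau : forall n A, measurable A -> P (tau n @^-1` A) = P A }.

Section exp_bounds.
Context {R : realType}.
Implicit Types b x p : R.

(** From exp(-b/2) >= 1 - b/2 > 0 one gets exp b <= (1 - b/2)^{-2}; what remains is a polynomial
    inequality with an explicit nonnegative remainder. *)
Lemma expR_quadratic_le b : `|b| <= 1 -> expR b <= 1 + b + 2 * b ^+ 2.
Proof.
rewrite ler_norml => /andP[b0 b1].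
have u1 : 1 - b / 2 <= expR (- (b / 2)) by rewrite -[X in X <= _]opprK opprB
  addrC; have := expR_ge1Dx (- (b / 2)); lra.
have v0 := expR_gt0 b.
have uv : expR b * expR (- (b / 2)) ^+ 2 = 1.
  by rewrite expr2 -!expRD -[RHS]expR0; congr expR; field.
set u := expR (- (b / 2)) in u1 uv; set v := expR b in v0 uv *.
have w0 : 0 < 1 - b / 2 by lra.
have w2 : 0 < (1 - b / 2) ^+ 2 by rewrite exprn_gt0.
rewrite -(ler_pM2r w2); apply: (@le_trans _ _ 1).
  by rewrite -[leRHS]uv ler_pM2l// ler_sqr ?nnegrE//; lra.
have -> : (1 + b + 2 * b ^+ 2) * (1 - b / 2) ^+ 2 = 1 + b ^+ 2 * ((1 - b) * (5 /
  4 - b / 2)) by field.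
by rewrite lerDl mulr_ge0 ?sqr_ge0// mulr_ge0//; lra.
Qed.

(** The subgaussian estimate cosh b <= exp(C b^2) behind Khinchin's inequality. The constant is not
    the optimal 1/2; it enters only the implied constants. *)
Lemma cosh_le b : `|b| <= 1 -> expR b + expR (- b) <= 2 * expR (2 * b ^+ 2).
Proof.
move=> b1; have h1 := expR_quadratic_le _ b1.
have h2 : expR (- b) <= 1 - b + 2 * b ^+ 2.
  by have := expR_quadratic_le (- b); rewrite normrN sqrrN; exact.
have := expR_ge1Dx (2 * b ^+ 2); lra.
Qed.

(** This is [|x| / p <= exp(|x| / p)] raised to the power [p]. It lets exponential moments control
    p-th moments. *)
Lemma powR_le_expR p x : 0 < p ->
  `|x| `^ p <= p `^ p * (expR x + expR (- x)).
Proof.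
move=> p0; have -> : `|x| = p * (`|x| / p) by field; rewrite gt_eqF.
rewrite powRM ?(ltW p0)// ?divr_ge0 ?(ltW p0)// ler_wpM2l ?powR_ge0//.
apply: (@le_trans _ _ (expR (`|x| / p) `^ p)).
  rewrite ge0_ler_powR ?nnegrE ?(ltW p0) ?expR_ge0 ?divr_ge0 ?(ltW p0)//.
  by have := expR_ge1Dx (`|x| / p); lra.
rewrite -expRM divfK ?gt_eqF//.
have [x0|x0] := leP 0 x; first by rewrite ger0_norm// lerDl expR_ge0.
by rewrite ltr0_norm// lerDr expR_ge0.
Qed.

End exp_bounds.

Lemma lee_double (R : realType) (x y : \bar R) (k : R) : (0 <= y)%E ->
  (x + x <= (2 * k)%:E * y)%E -> (x <= k%:E * y)%E.
Proof.
move=> y0 h; rewrite -(@lee_pmul2l _ 2%:E)// muleA -EFinM; apply: le_trans h.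
by rewrite (_ : 2%:E = 1%:E + 1%:E :> \bar R)%E// ge0_muleDl// !mul1e.
Qed.

Section rademacher.
Context {d} {T : measurableType d} {R : realType} {P : {measure set T -> \bar R}}
  {r : nat -> T -> R} {tau : nat -> T -> T}.
Hypothesis S : sign_flips P r tau.
Implicit Types (c : nat -> R) (N n : nat).

Definition rsum (r : nat -> T -> R) c N x := \sum_(k < N) c k * r k x.

Lemma rsumS c N x : rsum r c N.+1 x = rsum r c N x + c N * r N x.
Proof. by rewrite /rsum big_ord_recr. Qed.

Lemma measurable_rsum c N : measurable_fun [set: T] (rsum r c N).
Proof.
apply: measurable_sum => k; apply: measurable_funM => //.
exact: (measurable_sign _ _ _ S).
Qed.

Lemma rsum_tau c N n x : rsum r c N (tau n x) =
  if (n < N)%N then rsum r c N x - 2 * c n * r n x else rsum r c N x.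
Proof.
elim: N => [|N IH]; first by rewrite /rsum !big_ord0.
rewrite !rsumS IH (sign_tau _ _ _ S) ltnS.
by case: ltngtP => [nN|nN|->] //; ring.
Qed.

Lemma sign_sqr n x : r n x ^+ 2 = 1.
Proof. by case: (sign_flips1 _ _ _ S n x) => ->; rewrite ?sqrrN expr1n. Qed.

Lemma integral_flip n (F : T -> \bar R) : measurable_fun [set: T] F ->
  (forall x, 0 <= F x)%E -> (\int[P]_x F (tau n x) = \int[P]_x F x)%E.
Proof.
move=> mF F0.
rewrite -(ge0_integral_pushforward (measurable_tau _ _ _ S n) P measurableT mF)//.
apply: eq_measure_integral; first exact: (measurable_tau _ _ _ S).
by move=> ? A mA _; exact: (measure_tau _ _ _ S).
Qed.

Lemma integral_flipD n (F : T -> \bar R) : measurable_fun [set: T] F ->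
  (forall x, 0 <= F x)%E ->
  (\int[P]_x F x + \int[P]_x F x = \int[P]_x (F x + F (tau n x)))%E.
Proof.
move=> mF F0; rewrite ge0_integralD ?integral_flip//.
exact: (measurableT_comp mF (measurable_tau _ _ _ S n)).
Qed.

Section weighted.
Variable W : T -> \bar R.
Hypotheses (mW : measurable_fun [set: T] W) (W0 : forall x, (0 <= W x)%E).

Let mWE (f : T -> R) : measurable_fun [set: T] f ->
  measurable_fun [set: T] (fun x => W x * (f x)%:E)%E.
Proof. by move=> mf; apply: emeasurable_funM => //; exact/measurable_EFinP. Qed.

Let mexp c N : measurable_fun [set: T] (fun x => expR (rsum r c N x)).
Proof. by apply: measurableT_comp => //; exact: measurable_rsum. Qed.

(** The signs are integrated out one at a time: averaging over [tau N] turns the last factor into a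
    hyperbolic cosine, bounded by [cosh_le]. As [W] is invariant it stays a common factor, as if it
    were independent of the signs. *)
Lemma integral_exp_rsum c N : (forall n x, (n < N)%N -> W (tau n x) = W x) ->
  (forall n, (n < N)%N -> `|c n| <= 1) ->
  (\int[P]_x (W x * (expR (rsum r c N x))%:E) <=
   (expR (2 * \sum_(k < N) c k ^+ 2))%:E * \int[P]_x W x)%E.
Proof.
elim: N => [|N IH] WN cN.
  rewrite big_ord0 mulr0 expR0 mul1e; under eq_integral do
    rewrite /rsum big_ord0 expR0 mule1.
  by [].
have {}IH := IH (fun n x nN => WN n x (ltnW nN)) (fun n nN => cN n (ltnW nN)).
rewrite big_ord_recr/= mulrDr expRD mulrC EFinM -muleA.
apply: le_trans (lee_wpmul2l _ IH); last by rewrite lee_fin expR_ge0.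
apply: lee_double; first by apply: integral_ge0 => x _; rewrite mule_ge0//
  lee_fin expR_ge0.
rewrite (integral_flipD N); [|exact: mWE|by move=> x; rewrite mule_ge0// lee_fin
  expR_ge0].
rewrite -ge0_integralZl_EFin//; last 2 first.
- by move=> x _; rewrite mule_ge0// lee_fin expR_ge0.
- exact: mWE.
apply: ge0_le_integral => //.
- by move=> x _; rewrite adde_ge0// mule_ge0// lee_fin expR_ge0.
- apply: emeasurable_funD; first exact: mWE.
  exact: (measurableT_comp (mWE _ (mexp c N.+1)) (measurable_tau _ _ _ S N)).
- by apply: measurable_funeM; exact: mWE.
- move=> x _; rewrite WN// -ge0_muleDr ?lee_fin ?expR_ge0//.
  rewrite muleCA; apply: lee_wpmul2l => //; rewrite -EFinD -EFinM lee_fin.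
  rewrite rsum_tau ltnSn rsumS.
  have -> : rsum r c N x + c N * r N x - 2 * c N * r N x = rsum r c N x - c N * r
    N x by ring.
  rewrite !expRD -mulrDr mulrC ler_wpM2r ?expR_ge0//.
  apply: le_trans (cosh_le (c N) (cN _ (ltnSn N))).
  by case: (sign_flips1 _ _ _ S N x) => ->; rewrite ?mulr1 ?mulrN1 ?opprK// addrC.
Qed.

(** Dividing by [s] makes the squares of the coefficients sum to 1, so each is at most 1 in absolute
    value and the exponential moment is at most exp 2. The factor 2 comes from the two exponentials
    in [powR_le_expR]. *)
Lemma khinchin_upper (p : R) c N : 0 < p -> (forall n x, (n < N)%N -> W (tau n x)
  = W x) ->
  (\int[P]_x (W x * (`|rsum r c N x| `^ p)%:E) <=
   (2 * p `^ p * expR 2 * Num.sqrt (\sum_(k < N) c k ^+ 2) `^ p)%:E * \int[P]_x W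
     x)%E.
Proof.
move=> p0 WN; set s := Num.sqrt _.
have s2 : s ^+ 2 = \sum_(k < N) c k ^+ 2.
  by rewrite sqr_sqrtr// sumr_ge0// => k _; exact: sqr_ge0.
have := sqrtr_ge0 (\sum_(k < N) c k ^+ 2); rewrite -/s le_eqVlt => /predU1P[s0|s0].
  have c0 k : (k < N)%N -> c k = 0.
    move=> kN; apply/eqP; rewrite -sqrf_eq0; move: s2; rewrite -s0 expr0n/= =>
      /esym/eqP.
    rewrite psumr_eq0; last by move=> ? _; exact: sqr_ge0.
    by move=> /allP /(_ (Ordinal kN)); rewrite mem_index_enum => /(_ isT).
  rewrite integral0_eq ?mule_ge0 ?integral_ge0// ?lee_fin ?mulr_ge0 ?powR_ge0
    ?expR_ge0//.
  move=> x _; rewrite /rsum big1 ?normr0 ?powR0 ?gt_eqF ?mule0// => k _.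
  by rewrite c0 ?mul0r.
pose e n := c n / s.
have eE (a : R) x : rsum r (fun n => a * e n) N x = a / s * rsum r c N x.
  by rewrite /rsum mulr_sumr; apply: eq_bigr => k _; rewrite /e; ring.
have e2 : \sum_(k < N) e k ^+ 2 = 1.
  under eq_bigr do rewrite /e expr_div_n.
  by rewrite -mulr_suml -s2 mulfV// expf_neq0// gt_eqF.
have e1 n : (n < N)%N -> `|e n| <= 1.
  move=> nN; rewrite -(@ler_pXn2r _ 2) ?nnegrE// expr1n real_normK ?num_real//.
  rewrite -e2 (bigD1 (Ordinal nN))//= lerDl sumr_ge0// => k _; exact: sqr_ge0.
have Ie (a : R) : `|a| = 1 ->
    (\int[P]_x (W x * (expR (a / s * rsum r c N x))%:E) <= (expR 2)%:E *
      \int[P]_x W x)%E.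
  move=> a1; under eq_integral do rewrite -eE.
  apply: le_trans (integral_exp_rsum _ _ WN _) _.
    by move=> n nN; rewrite normrM a1 mul1r e1.
  under eq_bigr do rewrite exprMn -(real_normK (num_real a)) a1 expr1n mul1r.
  by rewrite e2 mulr1.
have K0 : 0 <= s `^ p * p `^ p by rewrite mulr_ge0// powR_ge0.
apply: (@le_trans _ _ ((s `^ p * p `^ p)%:E * (\int[P]_x (W x * (expR (1 / s *
  rsum r c N x))%:E) +
   \int[P]_x (W x * (expR (-1 / s * rsum r c N x))%:E)))%E); last first.
  apply: (@le_trans _ _ ((s `^ p * p `^ p)%:E * ((expR 2)%:E * \int[P]_x W x +
    (expR 2)%:E * \int[P]_x W x))%E).
    by rewrite lee_wpmul2l ?lee_fin// leeD ?Ie// ?normrN normr1.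
  rewrite -ge0_muleDl ?lee_fin ?expR_ge0// -EFinD muleA -EFinM le_eqVlt;
    apply/orP; left.
  by apply/eqP; congr (_%:E * _)%E; ring.
have mexp' (a : R) : measurable_fun [set: T] (fun x => expR (a / s * rsum r c N x)).
  by apply: measurableT_comp => //; apply: measurable_funM => //; exact:
    measurable_rsum.
have We (a : R) x : (0 <= W x * (expR (a / s * rsum r c N x))%:E)%E.
  by rewrite mule_ge0// lee_fin expR_ge0.
rewrite -ge0_integralD//; [|exact: mWE|exact: mWE].
rewrite -ge0_integralZl_EFin//; [|by move=> x _; rewrite adde_ge0|by apply:
  emeasurable_funD; exact: mWE].
apply: ge0_le_integral => //.
- by move=> x _; rewrite mule_ge0// lee_fin powR_ge0.
- apply: mWE; apply: (measurableT_comp (measurable_powR p)).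
  by apply: measurableT_comp => //; exact: measurable_rsum.
- by apply: measurable_funeM; apply: emeasurable_funD; exact: mWE.
- move=> x _; rewrite -ge0_muleDr ?lee_fin ?expR_ge0// muleCA lee_wpmul2l//.
  rewrite -EFinD -EFinM lee_fin.
  have gE : rsum r c N x = s * (1 / s * rsum r c N x) by field; rewrite gt_eqF.
  rewrite {1}gE normrM (gtr0_norm s0) powRM ?(ltW s0)// -[leRHS]mulrA ler_wpM2l
    ?powR_ge0//.
  have -> : -1 / s * rsum r c N x = - (1 / s * rsum r c N x) by rewrite !mulNr.
  exact: powR_le_expR.
Qed.

(** The sums at [x] and [tau n x] differ by [2 * c n] up to sign, so their absolute values add up to
    at least twice [|c n|], whatever the other coefficients are. *)
Lemma integral_coef_le c N n : (n < N)%N -> (forall x, W (tau n x) = W x) ->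
  (`|c n|%:E * \int[P]_x W x <= \int[P]_x (W x * `|rsum r c N x|%:E))%E.
Proof.
move=> nN Wn.
have mabs : measurable_fun [set: T] (fun x => `|rsum r c N x|).
  by apply: measurableT_comp => //; exact: measurable_rsum.
have I0 : (0 <= \int[P]_x W x)%E by exact: integral_ge0.
rewrite -(@lee_pmul2l _ 2%:E)//.
rewrite [leRHS](_ : _ = \int[P]_x (W x * `|rsum r c N x|%:E) + \int[P]_x (W x *
  `|rsum r c N x|%:E))%E; last first.
  rewrite (_ : 2%:E = 1%:E + 1%:E :> \bar R)%E// ge0_muleDl// !mul1e//.
rewrite (integral_flipD n); [|exact: mWE|by move=> x; rewrite mule_ge0].
rewrite muleA -EFinM -ge0_integralZl_EFin//.
apply: ge0_le_integral => //.
- by move=> x _; rewrite mule_ge0.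
- exact: measurable_funeM.
- apply: emeasurable_funD; first exact: mWE.
  exact: (measurableT_comp (mWE _ mabs) (measurable_tau _ _ _ S n)).
- move=> x _; rewrite Wn -ge0_muleDr ?lee_fin// muleC lee_wpmul2l// -EFinD lee_fin.
  rewrite rsum_tau nN; set g := rsum _ _ _ _.
  have -> : 2 * `|c n| = `|g - (g - 2 * c n * r n x)|.
    have -> : g - (g - 2 * c n * r n x) = 2 * c n * r n x by ring.
    rewrite !normrM normr_nat; case: (sign_flips1 _ _ _ S n x) => ->; rewrite
      ?normrN normr1 mulr1//.
  exact: ler_normB.
Qed.

End weighted.

Hypothesis P1 : P [set: T] = 1%E.

Let mpow c N k : measurable_fun [set: T] (fun x => (rsum r c N x ^+ k)%:E).
Proof. by apply/measurable_EFinP; apply: measurable_funX; exact: measurable_rsum.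
  Qed.

Let int_cst (a : R) : (\int[P]_x a%:E = a%:E)%E.
Proof. by rewrite (integral_cst P measurableT) P1 mule1. Qed.

(** Adding the values at [x] and [tau N x] cancels the cross term: this is orthonormality of the
    signs. *)
Lemma integral_rsum_sqr c N :
  (\int[P]_x (rsum r c N x ^+ 2)%:E = (\sum_(k < N) c k ^+ 2)%:E)%E.
Proof.
elim: N => [|N IH].
  rewrite big_ord0; under eq_integral do rewrite /rsum big_ord0 expr0n.
  exact: int_cst.
have := integral_flipD N _ (mpow c N.+1 2) (fun x => _).
rewrite [in RHS](_ : (fun x => _) = fun x => (2 * rsum r c N x ^+ 2)%:E + (2 * c
  N ^+ 2)%:E)%E; last first.
  apply/funext => x; rewrite -!EFinD rsum_tau ltnSn rsumS; congr EFin.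
  have -> : 2 * c N ^+ 2 = 2 * c N ^+ 2 * r N x ^+ 2 by rewrite sign_sqr mulr1.
  ring.
rewrite ge0_integralD//; last 3 first.
- by move=> x _; rewrite lee_fin mulr_ge0// sqr_ge0.
- by apply/measurable_EFinP; apply: measurable_funM => //; apply:
    measurable_funX; exact: measurable_rsum.
- by move=> x _; rewrite lee_fin mulr_ge0// sqr_ge0.
rewrite int_cst; under [X in _ = X + _]eq_integral do rewrite EFinM.
rewrite ge0_integralZl_EFin//; last by move=> x _; rewrite lee_fin sqr_ge0.
rewrite IH -EFinM -EFinD big_ord_recr/=; set I := integral _ _ _.
move=> /(_ (fun x => sqr_ge0 _)).
case: I => [a| |]//= [e]; congr EFin; lra.
Qed.

(** With s the sum of the first N squares and c the next coefficient, symmetrization adds 6 c^2 s +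
    c^4 to the fourth moment; the factor 3 is what makes the increase of 3 s^2 cover this. *)
Lemma integral_rsum_pow4 c N :
  (\int[P]_x (rsum r c N x ^+ 4)%:E <= (3 * (\sum_(k < N) c k ^+ 2) ^+ 2)%:E)%E.
Proof.
elim: N => [|N IH].
  rewrite big_ord0; under eq_integral do rewrite /rsum big_ord0 expr0n.
  by rewrite int_cst lee_fin expr0n mulr0.
have pow4_ge0 (a : R) : 0 <= a ^+ 4 by rewrite (exprM a 2 2) sqr_ge0.
have := integral_flipD N _ (mpow c N.+1 4) (fun x => pow4_ge0 _).
rewrite [in RHS](_ : (fun x => _) = fun x => 2%:E * (rsum r c N x ^+ 4)%:E +
    ((12 * c N ^+ 2)%:E * (rsum r c N x ^+ 2)%:E + (2 * c N ^+ 4)%:E))%E; last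
      first.
  apply/funext => x; rewrite -!EFinM -!EFinD rsum_tau ltnSn rsumS; congr EFin.
  by case: (sign_flips1 _ _ _ S N x) => ->; ring.
have c2 : 0 <= c N ^+ 2 by exact: sqr_ge0.
rewrite ge0_integralD//; last 4 first.
- by move=> x _; rewrite -EFinM lee_fin mulr_ge0.
- exact: measurable_funeM.
- move=> x _; rewrite -EFinM -EFinD lee_fin; apply: addr_ge0; last exact: mulr_ge0.
  by apply: mulr_ge0; [exact: mulr_ge0|exact: sqr_ge0].
- by apply: emeasurable_funD => //; exact: measurable_funeM.
rewrite ge0_integralD//; last 3 first.
- move=> x _; rewrite -EFinM lee_fin.
  by apply: mulr_ge0; [exact: mulr_ge0|exact: sqr_ge0].
- exact: measurable_funeM.
- by move=> x _; rewrite lee_fin mulr_ge0.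
rewrite int_cst !ge0_integralZl_EFin//; last 3 first.
- by move=> x _; rewrite lee_fin sqr_ge0.
- by rewrite mulr_ge0.
- by move=> x _; rewrite lee_fin.
rewrite integral_rsum_sqr big_ord_recr/=; move: IH.
set I := integral _ _ _; set J := integral _ _ _.
have s0 : 0 <= \sum_(k < N) c k ^+ 2 by rewrite sumr_ge0// => k _; exact: sqr_ge0.
move: (\sum_(k < N) c k ^+ 2) s0 => s s0.
have : (0 <= I)%E by apply: integral_ge0 => x _; rewrite lee_fin.
case: I => [a| |]//; rewrite lee_fin => a0; rewrite lee_fin => la.
case: J => [b| |]//= [e]; rewrite lee_fin.
have -> : 3 * (s + c N ^+ 2) ^+ 2 = 3 * s ^+ 2 + 6 * c N ^+ 2 * s + 3 * c N ^+ 4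
  by ring.
have := pow4_ge0 (c N); lra.
Qed.

Lemma khinchin_lower c N :
  ((3 / 8 * Num.sqrt (\sum_(k < N) c k ^+ 2))%:E <= \int[P]_x `|rsum r c N x|%:E)%E.
Proof.
set s := Num.sqrt _.
have s2 : \sum_(k < N) c k ^+ 2 = s ^+ 2.
  by rewrite sqr_sqrtr// sumr_ge0// => k _; exact: sqr_ge0.
have := sqrtr_ge0 (\sum_(k < N) c k ^+ 2); rewrite -/s le_eqVlt => /predU1P[<-|s0].
  by rewrite mulr0; apply: integral_ge0.
have pow4_ge0 (a : R) : 0 <= a ^+ 4 by rewrite (exprM a 2 2) sqr_ge0.
have mabs : measurable_fun [set: T] (fun x => `|rsum r c N x|%:E).
  by apply/measurable_EFinP; apply: measurableT_comp => //; exact: measurable_rsum.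
have K0 : 0 <= 3 / 4 / s by rewrite divr_ge0// ltW.
have L0 : 0 <= (8 * s ^+ 3)^-1 by rewrite invr_ge0 mulr_ge0// exprn_ge0// ltW.
(* With [u = |g| / s], [3/4 u^2 <= u + u^4 / 8] for [u >= 0]: the second and
   fourth moments bound the first one from below. *)
have : ((3 / 4 / s)%:E * \int[P]_x (rsum r c N x ^+ 2)%:E <= \int[P]_x `|rsum r c
  N x|%:E +
   ((8 * s ^+ 3)^-1)%:E * \int[P]_x (rsum r c N x ^+ 4)%:E)%E.
  rewrite -ge0_integralZl_EFin//; last by move=> x _; rewrite lee_fin sqr_ge0.
  rewrite -ge0_integralZl_EFin//; last by move=> x _; rewrite lee_fin.
  rewrite -ge0_integralD//; last 2 first.
  - by move=> x _; rewrite -EFinM lee_fin mulr_ge0.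
  - exact: measurable_funeM.
  apply: ge0_le_integral => //.
  - by move=> x _; rewrite -EFinM lee_fin mulr_ge0// sqr_ge0.
  - exact: measurable_funeM.
  - by apply: emeasurable_funD => //; exact: measurable_funeM.
  move=> x _; rewrite -!EFinM -EFinD lee_fin; set g := rsum _ _ _ _.
  have [u [u0 gu]] : exists u, 0 <= u /\ `|g| = s * u.
    by exists (`|g| / s); rewrite divr_ge0 ?(ltW s0)//; split => //; field;
      rewrite gt_eqF.
  have -> : g ^+ 4 = `|g| ^+ 4 by rewrite (exprM g 2 2) (exprM `|g| 2 2)
    real_normK ?num_real.
  rewrite -[g ^+ 2]real_normK ?num_real// gu -subr_ge0.
  (* The claim is u^3 - 6 u + 8 >= 0. The minimum is at sqrt 2; the square comes from subtracting
     from u^3 its tangent at the nearby rational point 3/2. *)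
  have -> : s * u + (8 * s ^+ 3)^-1 * (s * u) ^+ 4 - 3 / 4 / s * (s * u) ^+ 2 =
      s * (u / 8 * ((u - 3 / 2) ^+ 2 * (u + 3) + 3 / 4 * u + 5 / 4)).
    by field; rewrite gt_eqF.
  have q0 : 0 <= (u - 3 / 2) ^+ 2 * (u + 3) by rewrite mulr_ge0 ?sqr_ge0// addr_ge0.
  by rewrite mulr_ge0 ?(ltW s0)// mulr_ge0 ?divr_ge0//; lra.
rewrite integral_rsum_sqr s2.
have := integral_rsum_pow4 c N; rewrite s2.
have : (0 <= \int[P]_x `|rsum r c N x|%:E)%E by apply: integral_ge0.
have : (0 <= \int[P]_x (rsum r c N x ^+ 4)%:E)%E by apply: integral_ge0 => x _;
  rewrite lee_fin.
case: (\int[P]_x (rsum r c N x ^+ 4)%:E)%E => [a| |]//; rewrite lee_fin => a0.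
case: (\int[P]_x `|rsum r c N x|%:E)%E => [b| |]//; last by move=> *; rewrite leey.
rewrite !lee_fin => b0 a1.
(* The second moment gives 3/4 s, of which the fourth takes at most 3/8 s; the rest is the constant
   of the lemma. *)
have -> : 3 / 4 / s * s ^+ 2 = 3 / 4 * s by field; rewrite gt_eqF.
have : (8 * s ^+ 3)^-1 * a <= (8 * s ^+ 3)^-1 * (3 * (s ^+ 2) ^+ 2) by rewrite
  ler_wpM2l.
have -> : (8 * s ^+ 3)^-1 * (3 * (s ^+ 2) ^+ 2) = 3 / 8 * s by field; rewrite
  gt_eqF.
lra.
Qed.

End rademacher.

(** * A weight with spikes *)

Lemma N1_neq1 (R : numDomainType) : (-1 : R) <> 1.
Proof. by move=> /eqP; rewrite eqNr oner_eq0. Qed.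

Section cylinders.
Context {d} {T : measurableType d} {R : realType} {P : {measure set T -> \bar R}}
  {r : nat -> T -> R} {tau : nat -> T -> T}.
Hypothesis S : sign_flips P r tau.
Hypothesis P1 : P [set: T] = 1%E.
Implicit Types (s : seq nat) (e : nat -> R).

Definition cylinder (r : nat -> T -> R) s e : set T :=
  [set x | forall i, i \in s -> r i x = e i].

Lemma cylinder_tau s e n x : n \notin s ->
  cylinder r s e (tau n x) <-> cylinder r s e x.
Proof.
move=> ns; split => + i si => /(_ i si); rewrite (sign_tau _ _ _ S);
  by case: eqP => // ni; rewrite ni (negbTE ns) in si.
Qed.

Let msign i a : measurable [set x | r i x = a].
Proof.
by have := measurable_sign _ _ _ S i measurableT _ (measurable_set1 a); rewrite
  setTI.
Qed.

Lemma cylinder_cons i s e :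
  cylinder r (i :: s) e = cylinder r s e `&` [set x | r i x = e i].
Proof.
apply/seteqP; split => x /=.
  by move=> h; split; [move=> j sj; apply: h; rewrite inE sj orbT|apply: h;
    rewrite inE eqxx].
by move=> [h hi] j; rewrite inE => /predU1P[->//|]; exact: h.
Qed.

Lemma measurable_cylinder s e : measurable (cylinder r s e).
Proof.
elim: s => [|i s IH]; last by rewrite cylinder_cons; exact: measurableI.
by rewrite (_ : cylinder r [::] e = setT)//; apply/seteqP; split => // x _ i.
Qed.

(** A new index [i] cuts the cylinder over [s] into two parts that [tau i] exchanges, so each
    prescribed sign halves the measure. *)
Lemma measure_cylinder s e : uniq s -> (forall i, e i = 1 \/ e i = -1) ->
  P (cylinder r s e) = (2 ^- size s)%:E.
Proof.
move=> + e1; elim: s => [_|i s IH /= /andP[si /IH {}IH]].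
  by rewrite expr0 invr1 -P1; congr (P _); apply/seteqP; split => // x _ j.
rewrite cylinder_cons; set A := cylinder r s e in IH *.
have mA : measurable A by exact: measurable_cylinder.
have E : P A = (P (A `&` [set x | r i x = e i]) + P (A `&` [set x | r i x = e
  i]))%E.
  rewrite -[X in _ = (_ + X)%E](measure_tau _ _ _ S i); last exact: measurableI.
  rewrite -measureU; first last.
  - apply/seteqP; split => // x /= [[_ ri] [_ ri']].
    move: ri'; rewrite (sign_tau _ _ _ S) eqxx ri.
    by case: (e1 i) => ->; rewrite ?opprK; [|apply: nesym]; exact: N1_neq1.
  - rewrite -[X in measurable X]setTI; apply: (measurable_tau _ _ _ S) => //.
    exact: measurableI.
  - exact: measurableI.
  - congr (P _); apply/seteqP; split => x /=.
      move=> Ax; have [ri|ri] := eqVneq (r i x) (e i); [by left|right].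
      split; first exact/cylinder_tau.
      rewrite (sign_tau _ _ _ S) eqxx.
      move: ri; case: (sign_flips1 _ _ _ S i x) => ->; case: (e1 i) => ->;
        by rewrite ?opprK ?eqxx.
    by move=> [[]//|[/(cylinder_tau _ _ _ _ si)]].
move: E; rewrite IH exprS invfM.
case: (P _) => [a| |]// [e2]; congr EFin; lra.
Qed.

End cylinders.

Lemma sign_flips_sub {d} {T : measurableType d} {R : realType}
    {P : {measure set T -> \bar R}} {r : nat -> T -> R} {tau : nat -> T -> T}
    (f : nat -> nat) : injective f -> sign_flips P r tau ->
  sign_flips P (fun n => r (f n)) (fun n => tau (f n)).
Proof.
move=> fI [r1 mr mtau rtau Ptau]; split => // [n k x|n A mA]; last exact: Ptau.
by rewrite rtau (inj_eq fI).
Qed.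

Section weight.
Context {d} {T : measurableType d} {R : realType} {P : {measure set T -> \bar R}}
  {r : nat -> T -> R} {tau : nat -> T -> T}.
Hypothesis S : sign_flips P r tau.
Hypothesis P1 : P [set: T] = 1%E.

Definition block m : seq nat := [seq n.*2.+1 | n <- iota m (m ^ 2)].

Definition spike (r : nat -> T -> R) m : set T := cylinder r (block m) (fun=> 1).

Lemma block_uniq m : uniq (block m).
Proof. by rewrite map_inj_uniq ?iota_uniq// => i j [] /double_inj. Qed.

Lemma block_even m n : n.*2 \notin block m.
Proof.
apply/mapP => -[k _ e].
by have := congr1 odd e; rewrite /= !odd_double.
Qed.

Definition height m : R := 2^-1 ^+ m * 2 ^+ (m ^ 2).

Definition weight (r : nat -> T -> R) x : \bar R :=
  (\sum_(0 <= m <oo) (height m * \1_(spike r m) x)%:E)%E.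

Let h0 m : 0 <= height m.
Proof. by rewrite mulr_ge0// exprn_ge0// invr_ge0. Qed.

Let t0 m x : (0 <= (height m * \1_(spike r m) x)%:E)%E.
Proof. by rewrite lee_fin mulr_ge0. Qed.

Let mspike m : measurable (spike r m).
Proof. exact: (measurable_cylinder S). Qed.

Let mterm m : measurable_fun [set: T] (fun x => (height m * \1_(spike r m) x)%:E).
Proof.
by apply/measurable_EFinP; apply: measurable_funM => //; exact: measurable_indic.
Qed.

Lemma weight_ge0 x : (0 <= weight r x)%E.
Proof. by apply: nneseries_ge0. Qed.

Lemma measurable_weight : measurable_fun [set: T] (weight r).
Proof. by apply: ge0_emeasurable_sum. Qed.

Lemma weight_ge m x : spike r m x -> ((height m)%:E <= weight r x)%E.
Proof.
move=> mx; apply: le_trans (nneseries_lim_ge m.+1 _); last by [].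
rewrite big_nat_recr//= indicE mem_set// mulr1 leeDr//.
exact: sume_ge0.
Qed.

(** [block 0] is empty, so the term of index 0 is the constant 1. This makes [profile] at least 1
    almost everywhere, which the lower norm estimate needs. *)
Lemma weight_ge1 x : (1 <= weight r x)%E.
Proof.
have := @weight_ge 0 x; rewrite /height expr0 mul1r expr0; apply.
by move=> i; rewrite in_nil.
Qed.

Lemma weight_tau n x : weight r (tau n.*2 x) = weight r x.
Proof.
apply: eq_eseriesr => m _; congr (_ * _)%:E; rewrite !indicE.
suff -> : (tau n.*2 x \in spike r m) = (x \in spike r m) by [].
apply/idP/idP; rewrite !inE => /(cylinder_tau S _ _ _ _ (block_even m n));
  exact.
Qed.

Lemma integral_weight : (\int[P]_x weight r x = 2%:E)%E.
Proof.
rewrite integral_nneseries//.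
transitivity (\sum_(0 <= m <oo) (geometric 1 2^-1 m : R)%:E)%E.
  apply: eq_eseriesr => m _.
  under eq_integral do rewrite EFinM.
  rewrite ge0_integralZl_EFin//; last first.
    by apply/measurable_EFinP; exact: measurable_indic.
  rewrite integral_indic// setIT (measure_cylinder S P1)//; last first.
  - by move=> _; left.
  - exact: block_uniq.
  rewrite size_map size_iota -EFinM /height/= mul1r; congr EFin.
  by rewrite mulfK// expf_neq0.
apply/cvg_lim => //.
have : series (geometric 1 2^-1) n @[n --> \oo] --> (2 : R).
  have := @cvg_geometric_series R 1 2^-1.
  rewrite ger0_norm// invf_lt1// ltr1n => /(_ isT).
  by rewrite (_ : 1 * _ = 2 :> R)//; field.
move=> geo; rewrite (_ : (fun n => _) = EFin \o series (geometric 1 2^-1)).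
  by apply: cvg_EFin; [exact: nearW|exact: geo].
by apply/funext => n; rewrite /series/= -sumEFin.
Qed.

Lemma weight_fin : \forall x \ae P, weight r x \is a fin_num.
Proof.
suff : P.-integrable [set: T] (weight r).
  by move/(integrable_ae measurableT); apply: filterS => t /(_ I).
apply/integrableP; split; first exact: measurable_weight.
under eq_integral do rewrite gee0_abs ?weight_ge0//.
by rewrite integral_weight ltry.
Qed.

Implicit Types (c : nat -> R) (N : nat).
Variable p : R.
Hypothesis p1 : 1 <= p.
Let p0 : 0 < p. Proof. exact: lt_le_trans ltr01 p1. Qed.

(** [fine] sends an infinite weight to 0. The upper bound [profile_powR] survives this at every
    point; lower bounds hold off the null set of [weight_fin]. *)
Definition profile (r : nat -> T -> R) x : R := fine (weight r x) `^ p^-1.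

Definition spiked_sum (r : nat -> T -> R) (c : nat -> R) N x : R :=
  profile r x * rsum (fun n => r n.*2) c N x.

Let Se : sign_flips P (fun n => r n.*2) (fun n => tau n.*2).
Proof. by apply: (sign_flips_sub _ _ S); exact: double_inj. Qed.

Lemma profile_ge0 x : 0 <= profile r x.
Proof. exact: powR_ge0. Qed.

Lemma measurable_profile : measurable_fun [set: T] (profile r).
Proof.
apply: (measurableT_comp (measurable_powR p^-1)).
exact: (measurableT_comp _ measurable_weight).
Qed.

Lemma measurable_spiked_sum c N : measurable_fun [set: T] (spiked_sum r c N).
Proof.
apply: measurable_funM; first exact: measurable_profile.
exact: (measurable_rsum Se).
Qed.

Lemma profile_powR x : ((profile r x `^ p)%:E <= weight r x)%E.
Proof.
rewrite /profile -powRrM mulVf ?gt_eqF// powRr1 ?fine_ge0 ?weight_ge0//.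
by have := weight_ge0 x; case: (weight r x) => [y| |]//=; rewrite ?lexx ?leey.
Qed.

Lemma profile_ge x (a : R) : 0 <= a -> weight r x \is a fin_num ->
  (a%:E <= weight r x)%E -> a `^ p^-1 <= profile r x.
Proof.
move=> a0 wfin aw; rewrite ge0_ler_powR ?nnegrE ?fine_ge0 ?weight_ge0//.
  by rewrite invr_ge0 ltW.
by rewrite -lee_fin fineK.
Qed.

Lemma spiked_sum_upper c N :
  (\int[P]_x (`|spiked_sum r c N x| `^ p)%:E <=
    (4 * p `^ p * expR 2 * Num.sqrt (\sum_(k < N) c k ^+ 2) `^ p)%:E)%E.
Proof.
have := khinchin_upper Se _ measurable_weight weight_ge0 p c N p0 (fun n x _ =>
  weight_tau n x).
rewrite integral_weight -EFinM => h.
apply: le_trans (le_trans h _); last by rewrite lee_fin le_eqVlt; apply/orP;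
  left; apply/eqP; ring.
apply: ge0_le_integral => //.
- by apply: measurable_abs_powR; exact: measurable_spiked_sum.
- apply: emeasurable_funM; first exact: measurable_weight.
  by apply: measurable_abs_powR; exact: (measurable_rsum Se).
- move=> x _; rewrite /spiked_sum normrM (ger0_norm (profile_ge0 x)) powRM
    ?profile_ge0//.
  by rewrite EFinM lee_wpmul2r ?lee_fin ?powR_ge0// profile_powR.
Qed.

Lemma spiked_sum_lower c N :
  ((3 / 8 * Num.sqrt (\sum_(k < N) c k ^+ 2))%:E <=
    \int[P]_x `|spiked_sum r c N x|%:E)%E.
Proof.
apply: le_trans (khinchin_lower Se P1 c N) _.
apply: ae_ge0_le_integral => //.
- apply/measurable_EFinP; apply: measurableT_comp => //; exact: (measurable_rsum
    Se).
- apply/measurable_EFinP; apply: measurableT_comp => //; exact: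
    measurable_spiked_sum.
- apply: filterS weight_fin => x wfin _; rewrite lee_fin /spiked_sum normrM.
  rewrite ler_peMl// ger0_norm ?profile_ge0//.
  by have := profile_ge x 1 ler01 wfin (weight_ge1 x); rewrite powR1.
Qed.

Lemma spiked_sum_local c N n m (A : set T) : measurable A -> A `<=` spike r m ->
  (forall x, A (tau n.*2 x) <-> A x) -> (n < N)%N ->
  ((height m `^ p^-1 * `|c n|)%:E * P A <=
    \int[P]_(x in A) `|spiked_sum r c N x|%:E)%E.
Proof.
move=> mA Am An nN; set a := height m `^ p^-1.
have a0 : 0 <= a by exact: powR_ge0.
(* [integral_coef_le] is applied with this simple flip-invariant weight, which [profile] dominates
   almost everywhere on [A]. *)
pose W x := (a * \1_A x)%:E.
have mW : measurable_fun [set: T] W.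
  by apply/measurable_EFinP; apply: measurable_funM => //; exact: measurable_indic.
have W0 x : (0 <= W x)%E by rewrite lee_fin mulr_ge0.
have Wn x : W (tau n.*2 x) = W x.
  rewrite /W !indicE; suff -> : (tau n.*2 x \in A) = (x \in A) by [].
  by apply/idP/idP; rewrite !inE => /An.
have := integral_coef_le Se W mW W0 c N n nN Wn.
have -> : (\int[P]_x W x = a%:E * P A)%E.
  under eq_integral do rewrite /W EFinM.
  rewrite ge0_integralZl_EFin ?integral_indic ?setIT//.
  by apply/measurable_EFinP; exact: measurable_indic.
rewrite muleA -EFinM (mulrC `|_|) => h; apply: le_trans h _.
rewrite [leRHS]integral_mkcond.
have mS : measurable_fun [set: T] (fun x => `|spiked_sum r c N x|%:E).
  apply/measurable_EFinP; apply: measurableT_comp => //; exact: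
    measurable_spiked_sum.
apply: ae_ge0_le_integral => //.
- by move=> x _; rewrite mule_ge0.
- apply: emeasurable_funM => //.
  apply/measurable_EFinP; apply: measurableT_comp => //; exact: (measurable_rsum
    Se).
- by move=> x _; rewrite patchE; case: ifP.
- by apply/(measurable_restrictT _ mA); exact: measurable_funTS.
- apply: filterS weight_fin => x wfin _; rewrite patchE /W indicE.
  case: ifPn => xA; last by rewrite mulr0 mul0e.
  rewrite mulr1 -EFinM lee_fin /spiked_sum normrM ler_wpM2r//.
  rewrite (ger0_norm (profile_ge0 x)); apply: profile_ge => //.
  by apply: weight_ge; apply: Am; rewrite inE in xA.
Qed.

End weight.

(** * Linear embeddings of normed spaces *)

Section embedding.
Context {R : realType} {V W : normedModType R} (f : {linear W -> V}) (k K : R).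
Hypotheses (k0 : 0 < k) (f_ge : forall a, k * `|a| <= `|f a|)
  (f_le : forall a, `|f a| <= K * `|a|).

Let f_dist a b : k * `|a - b| <= `|f a - f b|.
Proof. by rewrite -linearB. Qed.

Let f_inj : injective f.
Proof.
move=> a b ab; have := f_dist a b; rewrite ab subrr normr0 pmulr_rle0//.
by rewrite normr_le0 subr_eq0 => /eqP.
Qed.

Let f_cont : continuous f.
Proof.
apply: bounded_linear_continuous; apply/ex_bound; exists (Num.max K 0).
apply/nbhs_norm0P; exists 1 => //= a /= a1.
apply: le_trans (f_le a) _; apply: (@le_trans _ _ (Num.max K 0 * `|a|)).
  by rewrite ler_wpM2r// le_max lexx.
by rewrite ler_piMr ?(ltW a1)// le_max lexx orbT.
Qed.

Lemma range_submod_closed : submod_closed [in range f].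
Proof.
split=> [|a u v]; rewrite !inE; first by exists 0 => //; rewrite linear0.
by move=> [x _ <-] [y _ <-]; exists (a *: x + y) => //; rewrite linearP.
Qed.

(** Since [f] is bounded below, preimages of a sequence converging in [V] form a Cauchy sequence in
    [W], and [f] maps its limit to the given point. *)
Lemma range_closed :
  (forall x : nat -> W, (forall e, 0 < e -> exists N, forall m n,
      (N <= m)%N -> (N <= n)%N -> `|x m - x n| <= e) ->
    exists l : W, x n @[n --> \oo] --> l) ->
  closed (range f).
Proof.
move=> complW y yf.
have [a ya] : {a : nat -> W & forall n, `|y - f (a n)| < 2^-1 ^+ n}.
  apply: (@choice _ _ (fun n a => `|y - f a| < 2^-1 ^+ n)) => n.
  have e0 : 0 < 2^-1 ^+ n :> R by rewrite exprn_gt0// invr_gt0.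
  have [z [[x _ <-] xb]] := yf _ (nbhsx_ballx y _ e0).
  by exists x; move: xb; rewrite -ball_normE.
have half_cvg : (2^-1 : R) ^+ n @[n --> \oo] --> (0 : R).
  by apply: cvg_expr; rewrite ger0_norm// invf_lt1// ltr1n.
have fay : f (a n) @[n --> \oo] --> y.
  apply/cvgrPdist_lt => e e0.
  have /cvgrPdist_lt /(_ e e0) := half_cvg; apply: filterS => n /=.
  by rewrite sub0r normrN => /(le_lt_trans (ler_norm _)); exact: lt_trans.
have [l al] : exists l : W, a n @[n --> \oo] --> l.
  apply: complW => e e0.
  have /cvgrPdist_lt /(_ (k * e / 2)) := half_cvg.
  rewrite divr_gt0 ?mulr_gt0// => /(_ isT) [N _ hN].
  exists N => m n Nm Nn; rewrite -(ler_pM2l k0); apply: le_trans (f_dist _ _) _.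
  rewrite -(subrKA y) (splitr (k * e)) (le_trans (ler_normD _ _))// lerD//.
    rewrite distrC; apply: ltW; apply: lt_trans (ya m) _.
    by have := hN m Nm; rewrite /= sub0r normrN; apply: le_lt_trans; exact:
      ler_norm.
  apply: ltW; apply: lt_trans (ya n) _.
  by have := hN n Nn; rewrite /= sub0r normrN; apply: le_lt_trans; exact: ler_norm.
exists l => //; apply: (@cvg_unique _ (@norm_hausdorff _ V) (f (a n) @[n -->
  \oo])) => //.
exact: (continuous_cvg _ (f_cont l) al).
Qed.

Lemma range_isomorphic : isomorphic_to W (range f).
Proof.
have [g gK] : {g : V -> W & forall y, range f y -> f (g y) = y}.
  apply: (@choice _ _ (fun y x => range f y -> f x = y)) => y.
  have [[x _ xy]|ny] := pselect (range f y); first by exists x.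
  (* Off the range any value will do: continuity of [g] is required only within the range. *)
  by exists 0.
exists f, g; split => //.
  by move=> x; apply: f_inj; rewrite gK//; exists x.
apply/subspace_continuousP => y fy; apply/cvgrPdist_le => e e0.
apply: (@filterS2 _ _ _ (fun z => `|y - z| < k * e) (range f)).
- move=> z yz fz /=; rewrite -(ler_pM2l k0) (le_trans (f_dist _ _))//.
  by rewrite !gK// ltW.
- apply: cvg_within; have /cvgrPdist_lt : z @[z --> y] --> y by exact: cvg_id.
  by apply; exact: mulr_gt0.
- exact: withinT.
Qed.

End embedding.

(** * The operator on ell^2 *)

Section coefficients.
Context {R : realType}.
Implicit Types (a : nat -> R) (N : nat).

(* The solution of [b (2j) = a j] and [b (2j+1) = b j / 2]: the exponent of 2 in
   [m + 1] is the number of trailing ones in the binary expansion of [m]. *)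
Definition spread a m : R :=
  2^-1 ^+ logn 2 m.+1 * a (m.+1 %/ 2 ^ logn 2 m.+1)./2.

Lemma spread_even a j : spread a j.*2 = a j.
Proof.
rewrite /spread lognE /= dvdn2 /= odd_double /= expr0 mul1r expn0 divn1.
by rewrite -[j.*2.+1]/(true + j.*2)%N half_bit_double.
Qed.

Lemma spread_odd a j : spread a j.*2.+1 = spread a j / 2.
Proof.
rewrite /spread -doubleS -mul2n lognM// logn_prime// expnS divnMl// exprS; ring.
Qed.

Lemma spreadD a b m : spread (fun n => a n + b n) m = spread a m + spread b m.
Proof. by rewrite /spread mulrDr. Qed.

Lemma spreadZ t a m : spread (fun n => t * a n) m = t * spread a m.
Proof. by rewrite /spread mulrCA. Qed.

Lemma sum_double (F : nat -> R) N :
  \sum_(k < N.*2) F k = \sum_(j < N) (F j.*2 + F j.*2.+1).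
Proof.
by elim: N => [|N IH]; rewrite ?big_ord0// doubleS !big_ord_recr/= IH addrA.
Qed.

Lemma spread_sqr_double a N : \sum_(k < N.*2) spread a k ^+ 2 =
  \sum_(j < N) a j ^+ 2 + 4^-1 * \sum_(j < N) spread a j ^+ 2.
Proof.
rewrite (sum_double (fun k => spread a k ^+ 2)) mulr_sumr -big_split/=; apply:
  eq_bigr => j _.
by rewrite spread_even spread_odd; field.
Qed.

(** Strong induction through [spread_sqr_double]: halving the range, rounded up, bounds the sum by B
    + (2 B) / 4, below 2 B. The rounded half is smaller than the range from 2 terms on, so 0 and 1
    are base cases. *)
Lemma spread_sqr_le a (B : R) N : (forall n, \sum_(j < n) a j ^+ 2 <= B) ->
  \sum_(k < N) spread a k ^+ 2 <= 2 * B.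
Proof.
move=> aB; have B0 : 0 <= B by have := aB 0; rewrite big_ord0.
have mono : {homo (fun n => \sum_(k < n) spread a k ^+ 2) :
    m n / (m <= n)%N >-> m <= n}.
  by apply/nondecreasing_seqP => n; rewrite big_ord_recr/= lerDl sqr_ge0.
elim/ltn_ind: N => -[_|[_|N IH]]; first by rewrite big_ord0 mulr_ge0.
  rewrite big_ord1 (spread_even a 0); have := aB 1; rewrite big_ord1; lra.
apply: (@le_trans _ _ (\sum_(k < (uphalf N.+2).*2) spread a k ^+ 2)).
  by apply: mono; rewrite -leq_uphalf_double.
rewrite spread_sqr_double.
have : (uphalf N.+2 < N.+2)%N by rewrite ltnS leq_uphalf_double -addnn; lia.
move=> /IH.
have := aB (uphalf N.+2); lra.
Qed.

Lemma spread_sqr_ge a N :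
  \sum_(j < N) a j ^+ 2 <= \sum_(k < N.*2) spread a k ^+ 2.
Proof.
rewrite spread_sqr_double lerDl mulr_ge0 ?invr_ge0// sumr_ge0// => j _.
exact: sqr_ge0.
Qed.

(** Passing from index n to 2n+1 halves a nonzero value and strictly increases the index. *)
Lemma spread_infinite a j k : a j != 0 -> exists2 n, (k <= n)%N & spread a n != 0.
Proof.
move=> aj; elim: k => [|k [n kn bn]]; first by exists j.*2; rewrite ?spread_even.
exists n.*2.+1; first by rewrite -addnn; lia.
by rewrite spread_odd mulf_neq0// invr_neq0.
Qed.

End coefficients.

Section ell2.
Context {R : realType}.
Implicit Types a b : ell2 R.

(** A nonempty set has positive counting measure, so the representative of an element of ell^2 is
    determined at each index. *)
Lemma ae_countingP (Q : nat -> Prop) :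
  (\forall n \ae (@counting nat R), Q n) -> forall n, Q n.
Proof.
move=> [N [_ N0 QN]] n; apply: contrapT => nQ.
have Nn : N n by exact: QN.
have : (@counting nat R [set n] <= 0)%E.
  by rewrite -N0; apply: le_measure; rewrite ?inE// => _ ->.
rewrite /counting; case: ifPn => [/asboolP fn|_]; last by rewrite leye_eq.
by rewrite fset_set1 finmap.cardfs1 lee_fin ler10.
Qed.

Lemma ell2_sqr a : ((`|a| ^+ 2)%:E = \sum_(0 <= n <oo) (Lrepr a n ^+ 2)%:E)%E.
Proof.
have := norm_LreprX a.
rewrite powR_mulrn// => ->; rewrite ge0_integral_count; last first.
  by move=> n; rewrite lee_fin powR_ge0.
by apply: eq_eseriesr => n _; rewrite powR_mulrn// real_normK ?num_real.
Qed.

Lemma ell2_partial_le a N : \sum_(n < N) Lrepr a n ^+ 2 <= `|a| ^+ 2.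
Proof.
rewrite -lee_fin ell2_sqr; apply: le_trans (nneseries_lim_ge N _).
  by rewrite -sumEFin big_mkord.
by move=> n _ _; rewrite lee_fin sqr_ge0.
Qed.

Lemma ell2_norm_le a (B : R) : 0 <= B ->
  (forall N, \sum_(n < N) Lrepr a n ^+ 2 <= B ^+ 2) -> `|a| <= B.
Proof.
move=> B0 aB; rewrite -(@ler_pXn2r _ 2) ?nnegrE// -lee_fin ell2_sqr.
apply: lime_le; first by apply: is_cvg_nneseries => n _ _; rewrite lee_fin sqr_ge0.
by apply: nearW => N; rewrite sumEFin lee_fin big_mkord.
Qed.

End ell2.

Lemma sum_tail {V : zmodType} (G : nat -> V) M N : (M <= N)%N ->
  \sum_(k < N) (if (k < M)%N then 0 else G k) = \sum_(k < N) G k - \sum_(k < M) G k.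
Proof.
move=> MN; rewrite -(big_mkord xpredT (fun k => if (k < M)%N then 0 else G k))
  -!(big_mkord xpredT G).
rewrite !(big_cat_nat (leq0n M) MN)/= [RHS]addrAC subrr add0r.
rewrite big_nat_cond big1 ?add0r; last by move=> k /andP[/andP[_ ->]].
by apply: eq_big_nat => k /andP[Mk _]; rewrite ltnNge Mk.
Qed.

(* Replaces Hoelder's inequality between L^1 and L^s, at the cost of a constant. *)
Lemma le_add_powR {R : realType} (s a u : R) : 1 <= s -> 0 < a -> 0 <= u ->
  u <= a + a `^ (1 - s) * u `^ s.
Proof.
move=> s1 a0 u0; have s0 : 0 < s by exact: lt_le_trans s1.
have [ua|ua] := leP u a.
  by rewrite (le_trans ua)// lerDl mulr_ge0// powR_ge0.
rewrite -(opprB s 1) powRN -(mulr_powRB1 u0 s0) mulrCA.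
rewrite -[X in X <= _]add0r lerD ?(ltW a0)// ler_peMr// mulrC ler_pdivlMr
  ?powR_gt0// mul1r.
by rewrite ge0_ler_powR ?nnegrE ?subr_ge0 ?(ltW ua) ?(ltW a0).
Qed.

Section spiked_operator.
Context {d} {T : measurableType d} {R : realType} {P : {measure set T -> \bar R}}
  {r : nat -> T -> R} {tau : nat -> T -> T}.
Hypothesis S : sign_flips P r tau.
Hypothesis P1 : P [set: T] = 1%E.
Context {p : R} (p1 : (1 <= p%:E)%E).
Implicit Types (c : nat -> R) (N : nat).
Local Notation Lp := (LspaceType P p1).

Let p0 : 0 < p. Proof. by rewrite (lt_le_trans ltr01). Qed.

Lemma spiked_sum_Lfun c N : spiked_sum p r c N \in Lfun P p%:E.
Proof.
rewrite Lfun_real//; last exact: (measurable_spiked_sum S).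
exact: le_lt_trans (spiked_sum_upper S P1 p p1 c N) (ltry _).
Qed.

Definition spiked_Lfun c N : LfunType P p1 := Lfun_Sub p1 (spiked_sum_Lfun c N).

Definition spiked c N : Lp := Lclass (spiked_Lfun c N).

Lemma spikedP (t : R) c1 c2 N :
  spiked (fun n => t * c1 n + c2 n) N = t *: spiked c1 N + spiked c2 N.
Proof.
rewrite /spiked -LclassZ -LclassD; congr Lclass; apply/LfuneqP => x.
change (spiked_sum p r (fun n => t * c1 n + c2 n) N x =
  t * spiked_sum p r c1 N x + spiked_sum p r c2 N x).
rewrite /spiked_sum /rsum mulrCA -mulrDr [t * _]mulr_sumr -big_split/=.
by congr (_ * _); apply: eq_bigr => k _; rewrite mulrDl mulrA.
Qed.

(** A difference of partial sums is a partial sum with truncated coefficients, so the norm estimates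
    apply to it and give the Cauchy property. *)
Lemma spiked_tail c M N : (M <= N)%N ->
  spiked c N - spiked c M = spiked (fun n => if (n < M)%N then 0 else c n) N.
Proof.
move=> MN; rewrite /spiked -LclassB; congr Lclass; apply/LfuneqP => x.
change (spiked_sum p r c N x - spiked_sum p r c M x =
  spiked_sum p r (fun n => if (n < M)%N then 0 else c n) N x).
rewrite /spiked_sum /rsum -mulrBr; congr (_ * _).
rewrite -(sum_tail (fun k => c k * r k.*2 x) _ _ MN); apply: eq_bigr => k _.
by case: ifP => _; rewrite ?mul0r.
Qed.

Definition spiked_const : R := (4 * p `^ p * expR 2) `^ p^-1.

Lemma spiked_const_gt0 : 0 < spiked_const.
Proof. by rewrite powR_gt0// !mulr_gt0// ?powR_gt0// expR_gt0. Qed.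

Lemma norm_spiked_le c N :
  `|spiked c N| <= spiked_const * Num.sqrt (\sum_(k < N) c k ^+ 2).
Proof.
apply: norm_LclassX_le; first by rewrite mulr_ge0 ?sqrtr_ge0// ltW//
  spiked_const_gt0.
apply: le_trans (spiked_sum_upper S P1 p p1 c N) _.
rewrite lee_fin powRM ?sqrtr_ge0// ?(ltW spiked_const_gt0)//.
by rewrite /spiked_const -powRrM mulVf ?gt_eqF// powRr1// !mulr_ge0 ?powR_ge0
  ?expR_ge0.
Qed.

Lemma integral_norm_le (x : Lp) : (\int[P]_t `|Lrepr x t|%:E <= (2 * `|x|)%:E)%E.
Proof.
have mx : measurable_fun [set: T] (fun t => `|Lrepr x t|).
  by apply: measurableT_comp => //; exact: Lrepr_measurable.
have [x0|x0] := eqVneq x 0.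
  rewrite (ae_eq_integral (cst 0%E))//; [|exact/measurable_EFinP|].
    by rewrite integral0 lee_fin mulr_ge0.
  by rewrite x0; apply: filterS (Lrepr0 P p1) => t -> _; rewrite normr0.
have nx : 0 < `|x| by rewrite normr_gt0.
(* [le_add_powR] at the threshold [|x|]: each of the two terms integrates to [|x|], whence the
   factor 2. *)
apply: (@le_trans _ _ (\int[P]_t (`|x|%:E + (`|x| `^ (1 - p))%:E * (`|Lrepr x t|
  `^ p)%:E)))%E.
  apply: ge0_le_integral => //.
  - exact/measurable_EFinP.
  - apply: emeasurable_funD => //; apply: measurable_funeM.
    exact: (measurable_abs_powR _ (Lrepr_measurable x)).
  - move=> t _; rewrite -EFinM -EFinD lee_fin.
    by apply: le_add_powR => //; rewrite -lee_fin.
rewrite ge0_integralD//; last first.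
  apply: measurable_funeM.
  exact: (measurable_abs_powR _ (Lrepr_measurable x)).
rewrite (integral_cst P measurableT) P1 mule1 ge0_integralZl_EFin ?powR_ge0//.
- rewrite -norm_LreprX -EFinM -EFinD lee_fin -powRD; last by rewrite (gt_eqF nx)
    implybT.
  by rewrite subrK powRr1//; lra.
- exact: (measurable_abs_powR _ (Lrepr_measurable x)).
Qed.

Lemma norm_spiked_ge c N :
  3 / 16 * Num.sqrt (\sum_(k < N) c k ^+ 2) <= `|spiked c N|.
Proof.
have := integral_norm_le (spiked c N).
rewrite (ae_eq_integral (fun t => `|spiked_sum p r c N t|%:E))//.
- move=> /(le_trans (spiked_sum_lower S P1 p p1 c N)); rewrite lee_fin; lra.
- by apply/measurable_EFinP; apply: measurableT_comp => //; exact: Lrepr_measurable.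
- apply/measurable_EFinP; apply: measurableT_comp => //.
  exact: (measurable_spiked_sum S).
- by apply: filterS (Lclass_ae (spiked_Lfun c N)) => t -> _.
Qed.

Lemma spiked_cvg c (B : R) : (forall N, \sum_(k < N) c k ^+ 2 <= B) ->
  exists l : Lp, spiked c N @[N --> \oo] --> l.
Proof.
move=> cB; pose s N := \sum_(k < N) c k ^+ 2.
have sS : {homo s : m n / (m <= n)%N >-> m <= n}.
  by apply/nondecreasing_seqP => n; rewrite /s big_ord_recr/= lerDl sqr_ge0.
have s_cvg : cvgn s.
  by apply: nondecreasing_is_cvgn => //; exists B => _ [n _ <-]; exact: cB.
have s_le n : s n <= limn s by exact: nondecreasing_cvgn_le.
apply: Lspace_complete => e e0.
pose D := e / spiked_const.
have D0 : 0 < D by rewrite divr_gt0// spiked_const_gt0.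
have [N0 _ hN0] : \forall n \near \oo, limn s - s n <= D ^+ 2.
  have /cvgrPdist_le /(_ (D ^+ 2)) := s_cvg; rewrite exprn_gt0// => /(_ isT).
  by apply: filterS => n; apply: le_trans; exact: ler_norm.
have main m n : (N0 <= n)%N -> (n <= m)%N -> `|spiked c m - spiked c n| <= e.
  move=> Nn nm; rewrite spiked_tail// (le_trans (norm_spiked_le _ _))//.
  rewrite mulrC -ler_pdivlMr ?spiked_const_gt0// -/D.
  rewrite -(ger0_norm (ltW D0)) -sqrtr_sqr ler_wsqrtr//.
  apply: le_trans (hN0 n Nn); apply: le_trans (lerB (s_le m) (lexx _)).
  rewrite -(sum_tail (fun k => c k ^+ 2) _ _ nm) ler_sum// => k _.
  by case: ifP => _; rewrite ?expr0n.
exists N0 => m n Nm Nn; have [nm|/ltnW mn] := leqP n m; first exact: main.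
by rewrite distrC; exact: main.
Qed.

(** The bound for the sum up to [N] is the same for all [N > n]. Replacing that sum by [l] costs at
    most the integral of the difference, which [integral_norm_le] bounds by twice its norm; hence
    the choice [e / 2]. *)
Lemma spiked_lim_local c (l : Lp) n m (A : set T) :
  spiked c N @[N --> \oo] --> l -> measurable A -> A `<=` spike r m ->
  (forall x, A (tau n.*2 x) <-> A x) ->
  ((height m `^ p^-1 * `|c n|)%:E * P A <= \int[P]_(x in A) `|Lrepr l x|%:E)%E.
Proof.
move=> cl mA Am An; apply/lee_addgt0Pr => e e0.
have /cvgrPdist_le /(_ (e / 2)) := cl; rewrite divr_gt0// => /(_ isT) [N1 _ hN].
pose N := maxn N1 n.+1.
have lN : `|l - spiked c N| <= e / 2 by apply: hN; rewrite /= leq_maxl.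
have nN : (n < N)%N by rewrite leq_maxr.
apply: le_trans (spiked_sum_local S P1 p p1 c N n m A mA Am An nN) _.
have mabs (x : Lp) : measurable_fun A (fun t => `|Lrepr x t|%:E).
  apply: measurable_funTS; apply/measurable_EFinP.
  by apply: measurableT_comp => //; exact: Lrepr_measurable.
apply: (@le_trans _ _ (\int[P]_(x in A) (`|Lrepr l x|%:E + `|Lrepr (l - spiked c
  N) x|%:E))%E).
  apply: ae_ge0_le_integral => //.
  - apply: measurable_funTS; apply/measurable_EFinP.
    by apply: measurableT_comp => //; exact: (measurable_spiked_sum S).
  - by move=> t _; rewrite adde_ge0.
  - exact: emeasurable_funD.
  apply: filterS3 (Lclass_ae (spiked_Lfun c N)) (LreprD l (- spiked c N))
    (Lrepr_opp (spiked c N)).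
  move=> t e1 e2 e3 _; rewrite -EFinD lee_fin e2.
  have -> : spiked_sum p r c N t = Lrepr (spiked c N) t by rewrite /spiked e1.
  have -> : Lrepr (- spiked c N) t = - Lrepr (spiked c N) t := e3.
  rewrite -{1}(subKr (Lrepr l t) (Lrepr (spiked c N) t)).
  exact: ler_normB.
rewrite ge0_integralD// leeD2l//.
apply: (@le_trans _ _ (\int[P]_t `|Lrepr (l - spiked c N) t|%:E)%E).
  apply: ge0_subset_integral => //; apply/measurable_EFinP.
  by apply: measurableT_comp => //; exact: Lrepr_measurable.
apply: le_trans (integral_norm_le _) _.
by rewrite lee_fin; lra.
Qed.

Lemma spiked_operator : exists f : {linear ell2 R -> Lp},
  [/\ forall a, spiked (spread (Lrepr a)) N @[N --> \oo] --> f a,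
      forall a, 3 / 16 * `|a| <= `|f a| &
      forall a, `|f a| <= 2 * spiked_const * `|a| ].
Proof.
have sqr_le (a : ell2 R) N : \sum_(k < N) spread (Lrepr a) k ^+ 2 <= 2 * `|a| ^+ 2.
  by apply: spread_sqr_le => n; exact: ell2_partial_le.
have [f fP] : {f : ell2 R -> Lp & forall a, spiked (spread (Lrepr a)) N @[N -->
  \oo] --> f a}.
  apply: (@choice _ _ (fun a l => spiked (spread (Lrepr a)) N @[N --> \oo] -->
    l)) => a.
  exact: spiked_cvg (sqr_le a).
have f_lin : linear f.
  move=> t a b; have c1 := fP (t *: a + b).
  have E : spread (Lrepr (t *: a + b)) = fun n => t * spread (Lrepr a) n + spread
    (Lrepr b) n.
    apply/funext => m; rewrite -spreadZ -spreadD; congr spread; apply/funext => n.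
    by rewrite (ae_countingP _ (LreprD (t *: a) b)) (ae_countingP _ (LreprZ t a)).
  rewrite E (_ : (fun N => _) = fun N => t *: spiked (spread (Lrepr a)) N +
    spiked (spread (Lrepr b)) N) in c1; last first.
    by apply/funext => N; exact: spikedP.
  apply: (@cvg_unique _ (@norm_hausdorff _ Lp) _ _ _ _ c1).
  by apply: cvgD => //; apply: cvgZr.
pose fL : {linear ell2 R -> Lp} := HB.pack f (GRing.isLinear.Build _ _ _ _ f f_lin).
exists fL; split => // a.
- rewrite -ler_pdivlMl//.
  apply: ell2_norm_le => [|N]; first by rewrite mulr_ge0.
  apply: le_trans (spread_sqr_ge _ N) _.
  set s := \sum_(k < _) _.
  have s0 : 0 <= s by rewrite sumr_ge0// => k _; exact: sqr_ge0.
  rewrite -[s]sqr_sqrtr// ler_sqr ?nnegrE ?sqrtr_ge0 ?mulr_ge0//.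
  rewrite ler_pdivlMl//.
  (* [s] collects the first [N.*2] terms of [spread], among which are the first [N] entries of [a];
     every later partial sum dominates it. *)
  apply: (ler_cvg_to (f := fun=> 3 / 16 * Num.sqrt s) _ (cvg_norm (fP a))).
    exact: cvg_cst.
  exists N.*2 => // M /= NM; apply: le_trans (norm_spiked_ge _ _).
  rewrite ler_pM2l// ler_wsqrtr//.
  rewrite /s -!(big_mkord xpredT (fun k => spread (Lrepr a) k ^+ 2))
    [leRHS](big_cat_nat (leq0n _) NM)/= lerDl.
  by rewrite sumr_ge0// => k _; exact: sqr_ge0.
- apply: (ler_cvg_to (g := fun=> 2 * spiked_const * `|a|) (cvg_norm (fP a))).
    exact: cvg_cst.
  apply: nearW => M; apply: le_trans (norm_spiked_le _ _) _.
  rewrite -mulrA mulrCA ler_pM2l ?spiked_const_gt0//.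
  (* The factor 2 rounds up the square root of 2 that comes from [spread_sqr_le]. *)
  have -> : 2 * `|a| = Num.sqrt ((2 * `|a|) ^+ 2) by rewrite sqrtr_sqr
    ger0_norm// mulr_ge0.
  by rewrite ler_wsqrtr// (le_trans (sqr_le a M))// exprMn ler_wpM2r ?sqr_ge0//;
    lra.
Qed.

End spiked_operator.

(** The quotient is 2 to the power m (m (theta - 1) - theta), which is at least 2^m > m once m
    (theta - 1) >= theta + 1. The three terms in [B] ensure [m >= k0], this inequality, and
    [D * m > K]. *)
Lemma height_unbounded {R : realType} (theta D K : R) (k0 : nat) : 1 < theta -> 0
  < D ->
  exists2 m, (k0 <= m)%N & K < D * (height m `^ theta / 2 ^+ (m ^ 2)).
Proof.
move=> th1 D0; have t0 : 0 < theta - 1 by rewrite subr_gt0.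
pose B := Num.max (Num.max k0%:R ((theta + 1) / (theta - 1))) (K / D).
pose m := Num.bound B; have Bm : B < m%:R by apply: archi_boundP; rewrite !le_max
  ler0n.
have : k0%:R < m%:R :> R by apply: le_lt_trans Bm; rewrite !le_max lexx.
rewrite ltr_nat => km.
have tm : theta + 1 <= m%:R * (theta - 1).
  by rewrite -ler_pdivrMr//; apply: ltW; apply: le_lt_trans Bm; rewrite !le_max
    lexx orbT.
have Km : K < D * m%:R.
  by rewrite mulrC -ltr_pdivrMr//; apply: le_lt_trans Bm; rewrite !le_max lexx orbT.
exists m; first exact: ltnW.
apply: lt_le_trans Km _; rewrite ler_pM2l//.
have e2 (j : nat) : 2 ^+ j = 2 `^ j%:R :> R by rewrite powR_mulrn.
have m2 : m%:R ^+ 2 = (m ^ 2)%:R :> R by rewrite natrX.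
have -> : height m = 2 `^ (m%:R ^+ 2 - m%:R) :> R.
  by rewrite /height powRB ?pnatr_eq0 ?implybT// m2 -!e2 exprVn mulrC.
rewrite -powRrM e2 -m2 -powRB ?pnatr_eq0 ?implybT//.
apply: (@le_trans _ _ (2 `^ m%:R)).
  by rewrite -e2 -natrX ler_nat ltnW// ltn_expl.
rewrite ler_powR ?ler1n// .
have -> : (m%:R ^+ 2 - m%:R) * theta - m%:R ^+ 2 = m%:R * (m%:R * (theta - 1) -
  theta) :> R by ring.
by rewrite ler_peMr ?ler0n//; lra.
Qed.

(** * Nowhere L^q *)

Section nowhere.
Context {R : realType} {p : R} (p1 : (1 <= p%:E)%E).
Local Notation P := (lebesgue01 R).
Local Notation mu := (@lebesgue_measure R).

Lemma lebesgue01_setT : P [set: _] = 1%E.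
Proof.
rewrite /lebesgue01 /lebesgue_on/= /mrestr setTI lebesgue_measure_itv/= lte_fin
  ltr01.
by rewrite -EFinB subr0.
Qed.

Lemma rad_sign_flips : sign_flips P (@rad R) (@flip R).
Proof.
split; [exact: rad1|exact: measurable_rad|exact: measurable_flip| |].
  by move=> n k x; exact: rad_flip.
by move=> n A mA; exact: lebesgue01_flip.
Qed.

(** Reduction to a finite exponent: as [U] has finite measure, an essentially bounded function also
    has exponent [p + 1]. *)
Lemma nowhere_real (f : measurableTypeR R -> R) (q : \bar R) (U : set R)
    (mU : measurable (U : set (measurableTypeR R))) :
  (p%:E < q)%E -> U `<=` `[0, 1] -> f \in Lfun (lebesgue_on mU) q ->
  exists2 r : R, p < r & (\int[lebesgue_on mU]_x (`|f x| `^ r)%:E < +oo)%E.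
Proof.
have p0 : 0 < p by rewrite (lt_le_trans ltr01).
move=> pq U01 fq.
have mf : measurable_fun [set: measurableTypeR R] f.
  by move: fq => /andP[+ _]; rewrite inE.
have Ufin : lebesgue_on mU [set: _] \is a fin_num.
  rewrite ge0_fin_numE// /lebesgue_on/= /mrestr setTI.
  apply: (@le_lt_trans _ _ (mu `[0, 1])).
    by apply: le_measure => //; rewrite inE//; exact: measurable_itv.
  by rewrite lebesgue_measure_itv/= lte_fin ltr01 -EFinB ltry.
have main (r : R) : p < r -> f \in Lfun (lebesgue_on mU) r%:E ->
    (\int[lebesgue_on mU]_x (`|f x| `^ r)%:E < +oo)%E.
  by move=> pr; rewrite Lfun_real// (lt_trans p0).
case: q pq fq => [r| |] pq fq; last by [].
  by exists r; [rewrite -lte_fin|apply: main; rewrite -?lte_fin].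
exists (p + 1); first by rewrite ltrDl.
apply: main; first by rewrite ltrDl.
apply: Lfun_subset fq => //; rewrite ?leey//.
by rewrite lee_fin (le_trans _ (_ : p <= _))// ?lerDl// -lee_fin.
Qed.

Lemma nowhere_spiked (c : nat -> R) (l : LspaceType P p1) :
  (forall k, exists2 n, (k <= n)%N & c n != 0) ->
  (spiked rad_sign_flips lebesgue01_setT p1 c N @[N --> \oo] --> l) -> S01 p1 l.
Proof.
have p0 : 0 < p by rewrite (lt_le_trans ltr01).
move=> c_inf cl q pq U mU [W oW UW] U0; apply/negP => fq.
have U01 : U `<=` `[0, 1] by rewrite UW; exact: subIsetr.
have [s ps If] := nowhere_real _ _ _ mU pq U01 fq.
have s0 : 0 < s by exact: lt_trans ps.
(* Digits describe points of [[0, 1[]; if the given point is 1, it is moved to the left inside the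
   open set [W]. *)
have [x0 [W0 x01]] : exists x0, W x0 /\ 0 <= x0 < 1.
  move: U0 => [x]; rewrite UW => -[Wx]; rewrite /= in_itv/= => /andP[x0].
  rewrite le_eqVlt => /predU1P[x1|x1]; last by exists x; rewrite x0.
  have /nbhs_ballP[e /= e0 be] := open_nbhs_nbhs (conj oW Wx).
  exists (1 - Num.min (e / 2) 1); split.
    apply: be; rewrite -ball_normE/= x1 opprB addrCA subrr addr0 ger0_norm.
      by rewrite gt_min; apply/orP; left; lra.
    by rewrite le_min ler01 andbT divr_ge0// ltW.
  rewrite subr_ge0 ge_min lexx orbT/= ltrBlDr ltrDl lt_min ltr01 andbT.
  by rewrite divr_gt0.
have [k kW] : exists k, forall y, 0 <= y < 1 -> (forall j, (j < k.*2)%N -> rad j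
  x0 = rad j y) -> W y.
  have /nbhs_ballP[e /= e0 be] := open_nbhs_nbhs (conj oW W0).
  have : (2^-1 : R) ^+ n @[n --> \oo] --> (0 : R).
    by apply: cvg_expr; rewrite ger0_norm// invf_lt1// ltr1n.
  move=> /cvgrPdist_lt /(_ e e0) [k _ hk]; exists k => y y01 xy.
  apply: be; rewrite -ball_normE/=; apply: lt_trans (dyadic_close _ _ _ x01 y01
    xy) _.
  have := hk k.*2; rewrite /= sub0r normrN ger0_norm; last first.
    by rewrite exprn_ge0// invr_ge0.
  by rewrite exprVn; apply; rewrite -addnn leq_addr.
have [n kn cn] := c_inf k.
set g := fun x => (`|Lrepr l x| `^ s)%:E.
pose K := fine (\int[lebesgue_on mU]_x g x)%E.
have KE : (\int[lebesgue_on mU]_x g x)%E = K%:E.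
  by rewrite fineK// ge0_fin_numE// integral_ge0// => x _; rewrite lee_fin powR_ge0.
(* Halving [|c n|] makes the lower bound of [spiked_lim_local] equal to [2 * b] times the measure of
   [A], so that one half remains after [le_add_powR] at the threshold [b] has used up the other. *)
pose a := `|c n| / 2; have a0 : 0 < a by rewrite divr_gt0// normr_gt0.
have [|//|m km hm] := @height_unbounded R (s / p) (a `^ s / 2 ^+ k.*2) K k.
- by rewrite ltr_pdivlMr// mul1r.
- by rewrite divr_gt0 ?powR_gt0 ?exprn_gt0.
pose e i := if (i < k.*2)%N then rad i x0 else 1.
have e1 i : e i = 1 \/ e i = -1 by rewrite /e; case: ifP => _; [exact: rad1|left].
pose L := iota 0 k.*2 ++ block m.
have block_ge i : i \in block m -> (k.*2 <= i)%N.
  by move=> /mapP[j]; rewrite mem_iota => /andP[mj _] ->; rewrite leqW//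
    leq_double (leq_trans km).
have L_uniq : uniq L.
  rewrite cat_uniq iota_uniq block_uniq andbT/=; apply/hasPn => i /block_ge ki.
  by rewrite mem_iota add0n/= -leqNgt.
pose A := cylinder (@rad R) L e.
have mA : measurable (A : set (measurableTypeR R)).
  exact: (measurable_cylinder rad_sign_flips).
have A_spike : A `<=` spike (@rad R) m.
  move=> x Ax i im; rewrite (Ax i); last by rewrite mem_cat im orbT.
  by rewrite /e ltnNge block_ge.
have A_inv x : A (flip n.*2 x) <-> A x.
  apply: (cylinder_tau rad_sign_flips); rewrite mem_cat negb_or block_even andbT.
  by rewrite mem_iota add0n/= -leqNgt leq_double.
have PA : P A = (2 ^- (k.*2 + m ^ 2))%:E.
  rewrite (measure_cylinder rad_sign_flips lebesgue01_setT)//.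
  by rewrite size_cat !size_map !size_iota.
have := spiked_lim_local rad_sign_flips lebesgue01_setT p1 c l n m A cl mA
  A_spike A_inv.
pose b := height m `^ p^-1 * a.
have h0 : 0 < height m :> R by rewrite mulr_gt0// exprn_gt0// invr_gt0.
have b0 : 0 < b by rewrite mulr_gt0// powR_gt0.
have -> : height m `^ p^-1 * `|c n| = 2 * b by rewrite /b /a; field.
have bE : b = height m `^ p^-1 * a by [].
clearbody b.
have mg : measurable_fun [set: measurableTypeR R] g.
  by apply: measurable_abs_powR; exact: Lrepr_measurable.
have g0 x : (0 <= g x)%E by rewrite lee_fin powR_ge0.
(* The cylinder [A] also has points outside [[0, 1[]. These are [P]-null, and on the part inside,
   which lies in [U], the two restrictions of Lebesgue measure agree. *)
have AK : (\int[P]_(x in A) g x <= K%:E)%E.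
  pose A1 : set R := A `&` `[0, 1[.
  have mI : measurable (`[(0 : R), 1[%classic : set (measurableTypeR R)) by
    exact: measurable_itv.
  have A1U : A1 `<=` U.
    move=> x [Ax]; rewrite /= in_itv/= => x01'; rewrite UW; split.
      apply: kW => // j jk; rewrite (Ax j) /e ?jk//.
      by rewrite mem_cat mem_iota add0n jk.
    by rewrite /= in_itv/=; case/andP: x01' => -> /ltW.
  have -> : (\int[P]_(x in A) g x = \int[P]_(x in A1) g x)%E.
    rewrite (@ge0_negligible_integral _ _ _ P A (~` `[0, 1[))//.
    - by rewrite setDE setCK.
    - exact: measurableC.
    - exact: measurable_funTS.
    - rewrite /lebesgue01 /lebesgue_on/= /mrestr.
      apply: (@subset_measure0 _ _ _ mu _ [set (1 : R)]) => //.
      + by apply: measurableI; [exact: measurableC|exact: measurable_itv].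
      + move=> x [] /=; rewrite !in_itv/= => nx /andP[x_ge0 x_le1].
        apply/eqP; rewrite eq_le x_le1 leNgt; apply/negP => x_lt1.
        by apply: nx; rewrite x_ge0.
      + exact: lebesgue_measure_set1.
  rewrite -KE (eq_measure_integral (lebesgue_on mU)).
    by apply: ge0_subset_integral => //; exact: measurableI.
  move=> B mB BA1; rewrite /lebesgue01 /lebesgue_on/= /mrestr.
  by rewrite !setIidl// => x /BA1/A1U//; exact: U01.
have up : (\int[P]_(x in A) `|Lrepr l x|%:E <= b%:E * P A + (b `^ (1 - s))%:E *
  K%:E)%E.
  apply: (@le_trans _ _ (\int[P]_(x in A) (b%:E + (b `^ (1 - s))%:E * g x))%E).
    apply: ge0_le_integral => //.
    - apply: measurable_funTS; apply/measurable_EFinP.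
      by apply: measurableT_comp => //; exact: Lrepr_measurable.
    - by apply: measurable_funTS; apply: emeasurable_funD => //; exact:
        measurable_funeM.
    - move=> x _; rewrite -EFinM -EFinD lee_fin; apply: le_add_powR => //.
      by apply: le_trans (ltW ps); rewrite -lee_fin.
  rewrite ge0_integralD//; last 3 first.
  - by move=> x _; rewrite lee_fin ltW.
  - by move=> x _; rewrite mule_ge0// lee_fin powR_ge0.
  - by apply: measurable_funTS; exact: measurable_funeM.
  rewrite (integral_cst P mA) leeD2l// ge0_integralZl_EFin ?powR_ge0//.
    by rewrite lee_wpmul2l// lee_fin powR_ge0.
  exact: measurable_funTS.
move=> /le_trans /(_ up); rewrite PA -!EFinM -EFinD lee_fin exprD invfM => h.
have {}h : b * (2 ^- k.*2 * 2 ^- (m ^ 2)) <= b `^ (1 - s) * K by lra.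
have : b `^ (s - 1) * (b * (2 ^- k.*2 * 2 ^- (m ^ 2))) <= b `^ (s - 1) * (b `^ (1
  - s) * K).
  by rewrite ler_pM2l// powR_gt0.
have pp : b `^ (s - 1) * b `^ (1 - s) = 1.
  rewrite -powRD; last by rewrite (gt_eqF b0) implybT.
  by rewrite -opprB addNr powRr0.
rewrite !mulrA pp mul1r.
rewrite [b `^ _ * b]mulrC (mulr_powRB1 (ltW b0) s0).
have -> : b `^ s = height m `^ (s / p) * a `^ s.
  by rewrite bE powRM ?powR_ge0 ?(ltW a0)// -powRrM [p^-1 * s]mulrC.
rewrite leNgt; apply/negP/negPn.
rewrite [X in _ < X](_ : _ = a `^ s / 2 ^+ k.*2 *
  (height m `^ (s / p) / 2 ^+ (m ^ 2)))//.
by ring.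
Qed.

End nowhere.

Theorem theorem3p6 (R : realType) (p : R) (p1 : (1 <= p%:E)%E) :
  spaceable (ell2 R) (S01 p1) /\
  exists M : set (LspaceType (lebesgue01 R) p1),
    [/\ submod_closed [in M], closed M, M `<=` S01 p1 `|` [set 0]
      & isomorphic_to (ell2 R) M].
Proof.
have [f [f_lim f_ge f_le]] := spiked_operator (@rad_sign_flips R) lebesgue01_setT
  p1.
have k0 : 0 < 3 / 16 :> R by rewrite divr_gt0.
have M_submod : submod_closed [in range f] by exact: range_submod_closed.
have M_closed : closed (range f).
  by apply: (range_closed f _ _ k0 f_ge f_le) => x xC; exact: Lspace_complete.
have M_iso : isomorphic_to (ell2 R) (range f).
  exact: (range_isomorphic f _ _ k0 f_ge f_le).
have M_S : range f `<=` S01 p1 `|` [set 0].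
  move=> _ [a _ <-]; have [->|a0] := eqVneq a 0.
    by right; rewrite /= linear0.
  left; apply: (nowhere_spiked p1 _ _ _ (f_lim a)) => k.
  suff [j aj] : exists j, Lrepr a j != 0 by exact: spread_infinite aj.
  apply: contrapT => a_all; case/negP: a0; rewrite -normr_eq0.
  apply/eqP/le_anti; rewrite normr_ge0 andbT; apply: ell2_norm_le => // N.
  rewrite big1 ?expr0n// => j _; apply/eqP; rewrite sqrf_eq0.
  by apply: contrapT => /negP aj; apply: a_all; exists (nat_of_ord j).
by split; exists (range f).
Qed.
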